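(* For any Koszul-Tate resolution $(S(\mathcal E_\bullet),\delta)$ of $\mathcal O/\mathcal I$ with each $\mathcal E_i$ a free $\mathcal O$-module, any maximal ideal $\mathcal J$ containing $\mathcal I$, and any $i\in\mathbb N$, $i\ge 1$, we have $\mathrm{rk}(\mathcal E_i)\ge b_i(\mathcal O/\mathcal I,\mathcal J)$.
   Context: $\mathbb K$ is the base field, of characteristic $0$, $\mathcal O$ a commutative $\mathbb K$-algebra, $\mathcal I\subset\mathcal O$ a proper ideal; maximal ideals $\mathcal J$ are assumed to satisfy $\mathcal O/\mathcal J\simeq\mathbb K$. $S(\mathcal E)$ is the graded symmetric $\mathcal O$-algebra of a graded $\mathcal O$-module, $S^{\ge2}(\mathcal E)=\bigoplus_{k\ge2}S^k(\mathcal E)$. Koszul-Tate resolution of $\mathcal O/\mathcal I$: a pair $(S(\mathcal E_\bullet),\delta)$ with $\mathcal E_\bullet=(\mathcal E_i)_{i\ge1}$ free/projective $\mathcal O$-modules ($\mathcal E_i$ in degree $i$) and $\delta$ a degree $-1$ ($\mathcal O$-linear) derivation with $\delta^2=0$, whose homology is zero except in degree $0$, where it is $\mathcal O/\mathcal I$. Given an ideal $\mathcal J\supseteq\mathcal I$, the reduced complex of $\mathcal O/\mathcal I$ evaluated at $\mathcal J$ (attached to $(S(\mathcal E_\bullet),\delta)$) is $(\mathcal E_\bullet\otimes_{\mathcal O}\mathcal O/\mathcal J,\underline\delta)$, in degrees $\ge1$, where $\underline\delta:\mathcal E_{i+1}\otimes\mathcal O/\mathcal J\to\mathcal E_i\otimes\mathcal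 O/\mathcal J$ ($i\ge1$) is induced by $\delta:\mathcal E_{i+1}\to S(\mathcal E)_i$ followed by the projection modulo $S^{\ge2}(\mathcal E)$ and modulo $\mathcal J\mathcal E_i$. Its homology does not depend, up to isomorphism, on the choice of the Koszul-Tate resolution of $\mathcal O/\mathcal I$. For $\mathcal J$ maximal it is a complex of $\mathbb K$-vector spaces, and $b_i(\mathcal O/\mathcal I,\mathcal J)\in\mathbb N\cup\{+\infty\}$ is the dimension of its $i$-th homology, computed from any Koszul-Tate resolution of $\mathcal O/\mathcal I$. *)

(* Defs.v *)
From HB Require Import structures.
From mathcomp Require Import all_boot all_order all_algebra.
From mathcomp Require Import ring_quotient.
From mathcomp Require Import boolp classical_sets functions cardinality.

Set Implicit Arguments.
Unset Strict Implicit.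
Unset Printing Implicit Defensive.

Import GRing.Theory.
Local Open Scope ring_scope.
Local Open Scope classical_set_scope.
Local Open Scope card_scope.

(* Elements of NN u {+oo}; None stands for +oo. *)
Definition enat := option nat.

Definition le_enat (x y : enat) : bool :=
  match x, y with
  | _, None => true
  | None, Some _ => false
  | Some m, Some n => (m <= n)%N
  end.

Definition has_card (T : Type) (X : set T) (c : enat) : Prop :=
  if c is Some n then X #= `I_n else infinite_set X.

Section Modules.
Variable O : comNzRingType.

Definition span (V : lmodType O) (X : set V) : set V :=
  [set v | exists (n : nat) (a : 'I_n -> O) (x : 'I_n -> V),
     (forall j, X (x j)) /\ v = \sum_(j < n) a j *: x j].

Definition is_basis (V : lmodType O) (X : set V) : Prop :=
  (forall (n : nat) (x : 'I_n -> V) (a : 'I_n -> O),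
     injective x -> (forall j, X (x j)) ->
     \sum_(j < n) a j *: x j = 0 -> forall j, a j = 0)
  /\ span X = setT.

Definition is_free (V : lmodType O) : Prop := exists X : set V, is_basis X.

(* The rank of a free module; it is well defined because O is a nonzero
   commutative ring. The default value None is irrelevant for free modules. *)
Definition rank (V : lmodType O) : enat :=
  xget None [set c | exists2 X : set V, is_basis X & has_card X c].

Definition is_projective (P : lmodType O) : Prop :=
  forall (M N : lmodType O) (p : {linear M -> N}) (f : {linear P -> N}),
    (forall y, exists x, p x = y) ->
    exists g : {linear P -> M}, forall x, p (g x) = f x.

(* The submodule J V. *)
Definition ideal_smul (J : {pred O}) (V : lmodType O) : set V :=
  span [set v | exists a x, a \in J /\ v = a *: x].

End Modules.

Section GradedSymmetricAlgebra.
Variables (O : comNzRingType) (E : nat -> lmodType O).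

Definition graded_commuting (B : algType O) (f : forall i, {linear E i -> B}) :=
  forall i j (x : E i) (y : E j),
    f i x * f j y = (-1) ^+ (i * j) * (f j y * f i x).

(* The graded symmetric algebra S(E), for E i placed in degree i, is the
   quotient of the tensor algebra of the direct sum of the E i by the relations
   x y = (-1)^(i j) y x; it is given here by the corresponding universal
   property, among all associative unital O-algebras. *)
Record symmetric_algebra := SymmetricAlgebra {
  sym_alg :> algType O;
  sym_gen : forall i, {linear E i -> sym_alg};
  sym_comm : graded_commuting sym_gen;
  sym_univ : forall (B : algType O) (f : forall i, {linear E i -> B}),
    graded_commuting f ->
    exists F : {lrmorphism sym_alg -> B},
      (forall i x, F (sym_gen i x) = f i x) /\
      (forall G : {lrmorphism sym_alg -> B},
         (forall i x, G (sym_gen i x) = f i x) -> G =1 F)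
}.

Variable S : symmetric_algebra.

Definition word (s : seq {i : nat & E i}) : S :=
  \prod_(p <- s) sym_gen S (tag p) (tagged p).

(* The degree n component of S(E). *)
Definition sym_deg (n : nat) : set S :=
  span [set w | exists2 s, sumn (map tag s) = n & w = word s].

(* S^{>=2}(E), for the grading by word length. *)
Definition sym_ge2 : set S :=
  span [set w | exists2 s, (2 <= size s)%N & w = word s].

End GradedSymmetricAlgebra.

(* Koszul-Tate resolutions of O/I. The graded module is indexed by the degree,
   hence the condition that it vanishes in degree 0. The degree 0 component of
   the algebra is O, so that kt_H0 says that the homology in degree 0 is O/I.
   Free modules being projective, this covers the free resolutions. *)
Record koszul_tate (O : comNzRingType) (I : {pred O}) := KoszulTate {
  kt_mod : nat -> lmodType O;
  kt_mod0 : forall x : kt_mod 0, x = 0;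
  kt_proj : forall i, (1 <= i)%N -> is_projective (kt_mod i);
  kt_sym : symmetric_algebra kt_mod;
  kt_diff : {linear kt_sym -> kt_sym};
  kt_diff_deg0 : forall a, sym_deg 0 a -> kt_diff a = 0;
  kt_diff_degS : forall n a, sym_deg n.+1 a -> sym_deg n (kt_diff a);
  kt_diffM : forall n a b, sym_deg n a ->
    kt_diff (a * b) = kt_diff a * b + (-1) ^+ n * (a * kt_diff b);
  kt_diffK : forall a, kt_diff (kt_diff a) = 0;
  kt_exact : forall n a, sym_deg n.+1 a -> kt_diff a = 0 ->
    exists2 b, sym_deg n.+2 b & kt_diff b = a;
  kt_H0 : forall c : O,
    (c \in I) <-> (exists2 b, sym_deg 1 b & kt_diff b = c%:A)
}.

Section ReducedComplex.
Variables (O : comNzRingType) (I : {pred O}) (R : koszul_tate I).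
Variable J : {pred O}.

(* y is the component in E_i = S^1(E)_i of the differential of x, i.e. its image
   under the projection modulo S^{>=2}(E), for i >= 1. *)
Definition linear_part (i : nat) (x : kt_mod R i.+1) (y : kt_mod R i) : Prop :=
  sym_ge2 (kt_diff R (sym_gen (kt_sym R) i.+1 x) - sym_gen (kt_sym R) i y).

(* The cycles and boundaries of the reduced complex, in degrees i >= 1, are
   represented by their inverse images in E_i under the projection
   E_i -> E_i / J E_i = E_i (x) O/J. In degree 1 every element is a cycle. *)
Definition reduced_cycles (i : nat) : set (kt_mod R i) :=
  match i with
  | k.+2 => [set x : kt_mod R k.+2 |
              exists2 y, linear_part x y & ideal_smul J y]
  | _ => setT
  end.

Definition reduced_boundaries (i : nat) : set (kt_mod R i) :=
  [set x | exists z y, linear_part z y /\ ideal_smul J (x - y)].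

End ReducedComplex.

Arguments reduced_cycles [O I] R J i.
Arguments reduced_boundaries [O I] R J i.

Section Betti.
Variables (K : fieldType) (O : comAlgType K).

Definition maximal_ideal (J : {pred O}) : Prop :=
  idealr_closed J /\
  forall J' : {pred O}, idealr_closed J' -> {subset J <= J'} -> J' =i J.

(* O/J is isomorphic to K as a K-algebra: J is the kernel of a morphism of
   K-algebras from O to K, which is surjective since it is unital. *)
Definition residue_field_is_base (J : {pred O}) : Prop :=
  exists ev : {lrmorphism O -> K^o}, forall a, (a \in J) = (ev a == 0).

(* X is (a set of representatives of) a K-basis of the quotient Z/B. *)
Definition is_basis_mod (V : lmodType O) (Z B X : set V) : Prop :=
  [/\ X `<=` Z,
      forall (n : nat) (x : 'I_n -> V) (c : 'I_n -> K),
        injective x -> (forall j, X (x j)) ->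
        B (\sum_(j < n) (c j)%:A *: x j) -> forall j, c j = 0
    & forall z, Z z -> exists (n : nat) (x : 'I_n -> V) (c : 'I_n -> K),
        (forall j, X (x j)) /\ B (z - \sum_(j < n) (c j)%:A *: x j)].

(* b_i(O/I, J). The dimension does not depend on the Koszul-Tate resolution R',
   nor on the basis. R' is chosen independently of any other resolution at
   hand. *)
Definition betti (I J : {pred O}) (i : nat) : enat :=
  xget None [set b | exists (R' : koszul_tate I) (X : set (kt_mod R' i)),
    is_basis_mod (reduced_cycles R' J i) (reduced_boundaries R' J i) X /\
    has_card X b].

End Betti.

(* Main.v *)
From HB Require Import structures.
From mathcomp Require Import all_boot all_order all_algebra.
From mathcomp Require Import ring_quotient finmap.
From mathcomp Require Import boolp classical_sets functions cardinality.
Require Import Defs.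

(* Two Koszul-Tate resolutions A and B of O/I are related by morphisms
   phi : A -> B and psi : B -> A of differential graded algebras over O, built
   degree by degree from projectivity and exactness. The same lifting argument,
   applied to the path algebra A[t] + A[t] dt, yields a morphism whose end
   points t = 0, 1 are psi phi and the identity. Integrating its dt-part from 0
   to 1, which needs characteristic 0, gives a chain homotopy h between psi phi
   and the identity that maps S^{>=2} to itself, hence acts on linear parts.
   Modulo J, a reduced cycle z of A such that the linear part of phi z vanishes
   is therefore a boundary. So m cycles of A that are linearly independent
   modulo boundaries have m linearly independent images in B_i / J B_i, where
   B_i are the generators of degree i of B; m is at most the rank of B_i. *)

Set Implicit Arguments.
Unset Strict Implicit.
Unset Printing Implicit Defensive.

Import GRing.Theory.
Local Open Scope ring_scope.
Local Open Scope classical_set_scope.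

(** * Submodules and projective modules *)

(** For the homology computed from [R] itself the bound is a mere count of vectors modulo [J]. The
    obstacle is that [betti] may come from another resolution, about which nothing is known beyond
    its axioms. Since only an inequality is wanted, no isomorphism in homology is built: one linear
    map that detects boundaries among cycles is enough, hence one homotopy. That homotopy has to
    respect word length, which a homotopy chosen degree by degree on modules has no reason to do. An
    algebra morphism into paths gives it: the image of a word of length at least 2 is a product, and
    every coefficient of its dt-part is a sum of products of two elements of positive degree. The
    differential does not respect word length, because it sends [E_1] to scalars. These scalars lie
    in [I], so the defect disappears modulo [J], and all identities between linear parts are used
    modulo [J] only. *)

Definition linmap (O : comNzRingType) (V W : lmodType O) (f : V -> W)
  (f_lin : linear f) : {linear V -> W} :=
  HB.pack f (GRing.isLinear.Build O V W *:%R f f_lin).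

Definition lrmap (O : comNzRingType) (A B : algType O) (f : A -> B)
  (f_lin : linear f) (f_mor : monoid_morphism f) : {lrmorphism A -> B} :=
  HB.pack f (GRing.isLinear.Build O A B *:%R f f_lin)
    (GRing.isMonoidMorphism.Build A B f f_mor).

Section Submodules.
Variables (O : comNzRingType) (V : lmodType O).

Definition submod (Y : set V) : Prop :=
  Y 0 /\ forall a x y, Y x -> Y y -> Y (a *: x + y).

Section Closure.
Variables (Y : set V) (sY : submod Y).

Lemma submod0 : Y 0. Proof. exact: sY.1. Qed.

Lemma submodD x y : Y x -> Y y -> Y (x + y).
Proof. by move=> Yx Yy; rewrite -[x]scale1r; apply: sY.2. Qed.

Lemma submodZ a x : Y x -> Y (a *: x).
Proof. by move=> Yx; rewrite -[_ *: _]addr0; apply: sY.2 => //; apply: submod0. Qed.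

Lemma submodN x : Y x -> Y (- x).
Proof. by move=> Yx; rewrite -scaleN1r; apply: submodZ. Qed.

Lemma submodB x y : Y x -> Y y -> Y (x - y).
Proof. by move=> Yx Yy; apply: submodD => //; apply: submodN. Qed.

Lemma submod_sum (T : Type) (r : seq T) (P : pred T) (F : T -> V) :
  (forall i, P i -> Y (F i)) -> Y (\sum_(i <- r | P i) F i).
Proof. by move=> YF; apply: big_ind => //; [exact: submod0|exact: submodD]. Qed.

Lemma submod_span (X : set V) v : (forall x, X x -> Y x) -> span X v -> Y v.
Proof.
move=> XY [n [a [x [Xx ->]]]]; apply: submod_sum => i _.
exact/submodZ/XY.
Qed.

End Closure.

Lemma span_incl (X : set V) x : X x -> span X x.
Proof.
move=> Xx; exists 1%N, (fun=> 1), (fun=> x); split=> //.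
by rewrite big_ord1 scale1r.
Qed.

Lemma span_submod (X : set V) : submod (span X).
Proof.
split=> [|c _ _ [n [a [x [Xx ->]]]] [m [b [y [Xy ->]]]]].
  by exists 0%N, (fun=> 0), (fun=> 0); split=> [[]//|]; rewrite big_ord0.
exists (n + m)%N,
  (fun i => match fintype.split i with inl j => c * a j | inr j => b j end),
  (fun i => match fintype.split i with inl j => x j | inr j => y j end).
split=> [i|]; first by case: fintype.split.
rewrite big_split_ord /= scaler_sumr; congr (_ + _); apply: eq_bigr => i _.
  by rewrite (unsplitK (inl i)) scalerA.
by rewrite (unsplitK (inr i)).
Qed.

Lemma ideal_smul_submod (J : {pred O}) : submod (@ideal_smul O J V).
Proof. exact: span_submod. Qed.

Lemma ideal_smulZ (J : {pred O}) a (x : V) : a \in J -> ideal_smul J (a *: x).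
Proof. by move=> Ja; apply: span_incl; exists a, x. Qed.

End Submodules.

Lemma preim_submod (O : comNzRingType) (V W : lmodType O) (f : {linear V -> W})
  (Y : set W) : submod Y -> submod [set v | Y (f v)].
Proof.
move=> sY; split=> [|a x y]; rewrite /= ?raddf0; first exact: submod0.
by rewrite linearP; apply: sY.2.
Qed.

Lemma ker_submod (O : comNzRingType) (V W : lmodType O) (f : {linear V -> W}) :
  submod [set v | f v = 0].
Proof.
by split=> [|a x y /= fx fy]; rewrite /= ?raddf0 // linearP fx fy scaler0 addr0.
Qed.

Lemma ideal_smul_linear (O : comNzRingType) (V W : lmodType O)
  (f : {linear V -> W}) (J : {pred O}) x : ideal_smul J x -> ideal_smul J (f x).
Proof.
apply: (submod_span (Y := [set v | ideal_smul J (f v)])).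
  exact/preim_submod/ideal_smul_submod.
by move=> _ [a [y [Ja ->]]]; rewrite /= linearZ; apply: ideal_smulZ.
Qed.

Section ProjectiveChoice.
Variables (O : comNzRingType) (P W : lmodType O).
Variables (G : set (P * W)%type) (sG : submod G).

Definition graph_mod of submod G := {v : P * W | `[< G v >]}.
HB.instance Definition _ := SubType.copy (graph_mod sG) {v : P * W | `[< G v >]}.
HB.instance Definition _ := Choice.copy (graph_mod sG) {v : P * W | `[< G v >]}.

Fact graph_closed : subsemimod_closed (fun v => `[< G v >]).
Proof.
split; first split.
- by rewrite unfold_in; apply/asboolP; apply: submod0.
- move=> x y; rewrite !unfold_in => /asboolP Gx /asboolP Gy.
  by apply/asboolP; apply: submodD.
- move=> a x; rewrite !unfold_in => /asboolP Gx; by apply/asboolP; apply: submodZ.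
Qed.

HB.instance Definition _ :=
  GRing.SubChoice_isSubLmodule.Build O (P * W)%type _ (graph_mod sG) graph_closed.

Lemma graph_fst_linear : linear (fun v : graph_mod sG => (val v).1).
Proof. by move=> a x y; rewrite linearP. Qed.

Lemma graph_snd_linear : linear (fun v : graph_mod sG => (val v).2).
Proof. by move=> a x y; rewrite linearP. Qed.

(** The first projection from the graph [G] to [P] is onto by totality. Projectivity splits it, and
    the second component of the splitting is a linear choice. *)
Lemma projective_choice : is_projective P -> (forall x, exists w, G (x, w)) ->
  exists f : {linear P -> W}, forall x, G (x, f x).
Proof.
move=> projP Gtot.
have [|g gP] := projP (graph_mod sG) P (linmap graph_fst_linear) idfun.
  move=> x; have [w /asboolP Gxw] := Gtot x.
  by exists (exist _ (x, w) Gxw).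
exists (linmap graph_snd_linear \o g) => x /=.
have /asboolP := valP (g x); have := gP x => /=.
by case: (val (g x)) => u v /= ->.
Qed.

End ProjectiveChoice.

Section AlgebraSubmodules.
Variables (O : comNzRingType) (B : algType O) (Y : set B) (sY : submod Y).

Lemma submod_preim_mulr b : submod [set a | Y (a * b)].
Proof.
split=> [|c x y]; rewrite /= ?mul0r; first exact: submod0.
by rewrite mulrDl -scalerAl; apply: sY.2.
Qed.

Lemma submod_preim_mull b : submod [set a | Y (b * a)].
Proof.
split=> [|c x y]; rewrite /= ?mulr0; first exact: submod0.
by rewrite mulrDr -scalerAr; apply: sY.2.
Qed.

Lemma submod_span_mul (X X' : set B) :
  (forall x x', X x -> X' x' -> Y (x * x')) ->
  forall a b, span X a -> span X' b -> Y (a * b).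
Proof.
move=> XY a b Xa Xb; apply: (submod_span (submod_preim_mulr b) _ Xa) => x Xx.
apply: (submod_span (submod_preim_mull x) _ Xb) => x' Xx' /=; exact: XY.
Qed.

End AlgebraSubmodules.

(** * Square-zero extensions *)

Section TrivialExtension.
Variables (O : comNzRingType) (M : lmodType O).

(** The sum of [O] and an ideal [M] of square zero. An algebra morphism into it is a character
    together with a derivation along this character, which is how the projection onto generators
    will arise. *)
Definition trivext := (O^o * M)%type.
HB.instance Definition _ := GRing.Lmodule.on trivext.

Definition trivext_mul (u v : trivext) : trivext :=
  (u.1 * v.1, u.1 *: v.2 + v.1 *: u.2).
Definition trivext_one : trivext := (1, 0).

Fact trivext_mulA : associative trivext_mul.
Proof.
case=> [a x] [b y] [c z]; rewrite /trivext_mul /= mulrA; congr (_, _).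
by rewrite !scalerDr !scalerA addrA (mulrC c b) (mulrC c a).
Qed.

Fact trivext_mul1r : left_id trivext_one trivext_mul.
Proof. by case=> a x; rewrite /trivext_mul /= mul1r scale1r scaler0 addr0. Qed.

Fact trivext_mulr1 : right_id trivext_one trivext_mul.
Proof. by case=> a x; rewrite /trivext_mul /= mulr1 scale1r scaler0 add0r. Qed.

Fact trivext_mulDl : left_distributive trivext_mul +%R.
Proof.
case=> [a x] [b y] [c z]; rewrite /trivext_mul /= mulrDl; congr (_, _).
by rewrite /= scalerDl scalerDr addrACA.
Qed.

Fact trivext_mulDr : right_distributive trivext_mul +%R.
Proof.
case=> [a x] [b y] [c z]; rewrite /trivext_mul /= mulrDr; congr (_, _).
by rewrite /= scalerDl scalerDr addrACA.
Qed.

Fact trivext_one_neq0 : trivext_one != 0.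
Proof. by rewrite /eq_op /= oner_eq0. Qed.

HB.instance Definition _ := GRing.Zmodule_isNzRing.Build trivext trivext_mulA
  trivext_mul1r trivext_mulr1 trivext_mulDl trivext_mulDr trivext_one_neq0.

Fact trivext_scaleAl (a : O) (u v : trivext) : a *: (u * v) = (a *: u) * v.
Proof.
case: u v => [b x] [c y]; congr (_, _); first by rewrite /= scalerAl.
by rewrite /= scalerDr !scalerA (mulrC a c).
Qed.

HB.instance Definition _ :=
  GRing.Lmodule_isLalgebra.Build O trivext trivext_scaleAl.

Fact trivext_scaleAr (a : O) (u v : trivext) : a *: (u * v) = u * (a *: v).
Proof.
case: u v => [b x] [c y]; congr (_, _); first by rewrite /= scalerAr.
by rewrite /= scalerDr !scalerA (mulrC a b).
Qed.

HB.instance Definition _ :=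
  GRing.Lalgebra_isAlgebra.Build O trivext trivext_scaleAr.

End TrivialExtension.

(** * Graded symmetric algebras *)

Section SymmetricAlgebra.
Variables (O : comNzRingType) (E : nat -> lmodType O) (S : symmetric_algebra E).

Lemma sym_mor_ext (B : algType O) (F G : {lrmorphism S -> B}) :
  (forall i x, F (sym_gen S i x) = G (sym_gen S i x)) -> F =1 G.
Proof.
move=> FG.
have comm : graded_commuting (fun i => F \o sym_gen S i : {linear E i -> B}).
  move=> i j x y /=; have := congr1 F (sym_comm S x y).
  by rewrite !rmorphM rmorphXn rmorphN1.
have [H [_ Huniq]] := sym_univ S comm.
by move=> a; rewrite (Huniq F) // (Huniq G) // => i x; rewrite -FG.
Qed.

Lemma word_cons p s : word S (p :: s) = sym_gen S (tag p) (tagged p) * word S s.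
Proof. by rewrite /word big_cons. Qed.

Lemma word_nil : word S [::] = 1. Proof. by rewrite /word big_nil. Qed.

Lemma word_cat s t : word S (s ++ t) = word S s * word S t.
Proof. by rewrite /word big_cat. Qed.

Lemma word1 i x : word S [:: existT E i x] = sym_gen S i x.
Proof. by rewrite word_cons word_nil mulr1. Qed.

Definition word_span : set S := span [set w | exists s, w = word S s].

Definition word_span_alg := {a : S | `[< word_span a >]}.
HB.instance Definition _ :=
  SubType.copy word_span_alg {a : S | `[< word_span a >]}.
HB.instance Definition _ :=
  Choice.copy word_span_alg {a : S | `[< word_span a >]}.

Lemma word_span_word s : word_span (word S s).
Proof. by apply: span_incl; exists s. Qed.

Fact word_span_closed : GRing.subsemialg_closed (fun a => `[< word_span a >]).
Proof.
have sW : submod word_span by apply: span_submod.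
split; [|split| |].
- rewrite unfold_in; apply/asboolP; rewrite -word_nil.
  exact: word_span_word.
- by rewrite unfold_in; apply/asboolP; apply: submod0.
- move=> x y; rewrite !unfold_in => /asboolP Gx /asboolP Gy.
  by apply/asboolP; apply: submodD.
- move=> a x; rewrite !unfold_in => /asboolP Gx.
  by apply/asboolP; apply: submodZ.
- move=> x y; rewrite !unfold_in => /asboolP Gx /asboolP Gy.
  apply/asboolP; apply: (submod_span_mul sW _ Gx Gy) => _ _ [s ->] [t ->].
  by rewrite -word_cat; apply: word_span_word.
Qed.

HB.instance Definition _ :=
  GRing.SubChoice_isSubAlgebra.Build O S _ word_span_alg word_span_closed.

(* The span of the words is a subalgebra containing the generators, so by the
   universal property the identity of S factors through it. *)
Lemma sym_word_span a : word_span a.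
Proof.
pose f0 i (x : E i) : word_span_alg :=
  exist _ (sym_gen S i x) (asboolT (eq_ind _ _ (word_span_word _) _ (word1 x))).
have f_lin i : linear (@f0 i) by move=> c x y; apply: val_inj; apply: linearP.
pose f i := linmap (f_lin i).
have comm : graded_commuting f.
  move=> i j x y; apply: val_inj; rewrite !rmorphM rmorphXn rmorphN1 /=.
  exact: sym_comm.
have [F [Ff _]] := sym_univ S comm.
have val_lin : linear (val : word_span_alg -> S) by move=> c x y; apply: linearP.
have val_mor : monoid_morphism (val : word_span_alg -> S).
  by split=> [|x y]; rewrite ?rmorph1 ?rmorphM.
have valF : idfun =1 lrmap val_lin val_mor \o F.
  by apply: sym_mor_ext => i x /=; rewrite Ff.
rewrite [a](valF a); exact/asboolP/(valP (F a)).
Qed.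

Lemma sym_ind (Y : set S) : submod Y -> (forall s, Y (word S s)) -> forall a, Y a.
Proof.
by move=> sY Yw a; apply: (submod_span sY _ (sym_word_span a)) => _ [s ->].
Qed.

Lemma sym_deg_submod n : submod (@sym_deg O E S n).
Proof. exact: span_submod. Qed.

Lemma sym_ge2_submod : submod (@sym_ge2 O E S).
Proof. exact: span_submod. Qed.

Lemma sym_deg_word s : sym_deg (sumn (map tag s)) (word S s).
Proof. by apply: span_incl; exists s. Qed.

Lemma sym_deg1 : sym_deg 0 (1 : S).
Proof. by rewrite -word_nil; apply: (sym_deg_word [::]). Qed.

Lemma sym_deg_gen i x : sym_deg i (sym_gen S i x).
Proof. by have := sym_deg_word [:: existT E i x]; rewrite word1 /= addn0. Qed.

Lemma sym_deg_ind n (Y : set S) : submod Y ->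
  (forall s, sumn (map tag s) = n -> Y (word S s)) ->
  forall a, sym_deg n a -> Y a.
Proof.
by move=> sY Yw a; apply: submod_span => // _ [s sn ->]; apply: Yw.
Qed.

Lemma sym_homogeneous_ind (Y : set S) : submod Y ->
  (forall n a, sym_deg n a -> Y a) -> forall a, Y a.
Proof. by move=> sY Yh; apply: sym_ind => // s; apply/Yh/sym_deg_word. Qed.

Lemma sym_degM m n (a b : S) : sym_deg m a -> sym_deg n b -> sym_deg (m + n) (a * b).
Proof.
move=> sa sb; apply: (submod_span_mul (sym_deg_submod _) _ sa sb).
move=> _ _ [s <- ->] [t <- ->]; rewrite -word_cat -sumn_cat -map_cat.
exact: sym_deg_word.
Qed.

(** The sign rule passes from generators to words by induction on one factor at a time, then to
    homogeneous elements because both sides are linear in each factor. *)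
Lemma sym_deg_comm m n (a b : S) : sym_deg m a -> sym_deg n b ->
  a * b = (-1) ^+ (m * n) * (b * a).
Proof.
have skewC (k : nat) (x y : S) : (-1) ^+ k * (x * y) = x * ((-1) ^+ k * y).
  by rewrite mulrA -commr_sign -mulrA.
have gen i x s : sym_gen S i x * word S s =
    (-1) ^+ (i * sumn (map tag s)) * (word S s * sym_gen S i x).
  elim: s => [|[j y] s IHs] /=.
    by rewrite word_nil muln0 mul1r mulr1 mul1r.
  rewrite word_cons /= mulrA sym_comm -!mulrA IHs -skewC.
  by rewrite mulnDr exprD -!mulrA.
have words s t : word S s * word S t =
    (-1) ^+ (sumn (map tag s) * sumn (map tag t)) * (word S t * word S s).
  elim: s => [|[i x] s IHs] /=; first by rewrite word_nil mul0n mul1r mulr1 mul1r.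
  rewrite word_cons -mulrA IHs -skewC !mulrA -(mulrA _ (sym_gen _ _ _)) gen.
  by rewrite mulnDl addnC exprD -!mulrA.
move=> am bn.
pose comm_with (c : S) : set S := [set x | x * c = (-1) ^+ (m * n) * (c * x)].
have sC c : submod (comm_with c).
  rewrite /comm_with; split=> [|k x y /= xc yc]; first by rewrite /= mul0r !mulr0.
  by rewrite mulrDl mulrDr mulrDr -scalerAl xc yc -!scalerAr.
pose comm_with' (c : S) : set S := [set x | c * x = (-1) ^+ (m * n) * (x * c)].
have sC' c : submod (comm_with' c).
  rewrite /comm_with'; split=> [|k x y /= xc yc]; first by rewrite /= mul0r !mulr0.
  by rewrite mulrDl !mulrDr -scalerAr xc yc -scalerAl -scalerAr.
apply: (sym_deg_ind (sC b) _ am) => s sm.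
apply: (sym_deg_ind (sC' _) _ bn) => t tn.
by rewrite /comm_with' /= words sm tn.
Qed.

End SymmetricAlgebra.

Section Parity.
Variables (O : comNzRingType) (E : nat -> lmodType O) (S : symmetric_algebra E).

(** Moving dt past an element costs a sign that depends on the degree, while the path algebra needs
    a map defined on all of [S]. The universal property supplies it: multiplying each generator by
    its sign preserves the commutation relations. *)
Lemma parity_exists : exists F : {lrmorphism S -> S},
  forall n a, sym_deg n a -> F a = (-1) ^+ n * a.
Proof.
have sgn_scale k (a : S) : (-1) ^+ k * a = (-1) ^+ k *: a.
  by rewrite -signr_odd mulr_sign -[in RHS]signr_odd scaler_sign.
pose f i : {linear E i -> S} := linmap (linearP ((-1) ^+ i \*: sym_gen S i)).
have comm : graded_commuting f.
  move=> i j x y /=; rewrite -!scalerAl -!scalerAr sym_comm !scalerA.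
  by rewrite mulrC.
have [F [Ff _]] := sym_univ S comm.
exists F => n a; apply: (sym_deg_ind (Y := [set a | F a = (-1) ^+ n * a])) => [|s].
  split=> [|c x y /= Fx Fy]; rewrite /= ?raddf0 ?mulr0 //.
  by rewrite linearD linearZ /= Fx Fy mulrDr -scalerAr.
elim: s n => [|[i x] s IHs] n /= <-.
  by rewrite word_nil rmorph1 mulr1.
rewrite word_cons rmorphM /= (IHs _ erefl) Ff /= !sgn_scale -scalerAl -scalerAr.
by rewrite scalerA exprD.
Qed.

Definition parity : {lrmorphism S -> S} := projT1 (cid parity_exists).

Lemma parityE n a : sym_deg n a -> parity a = (-1) ^+ n * a.
Proof. exact: (projT2 (cid parity_exists)). Qed.

Lemma parity_deg n a : sym_deg n a -> sym_deg n (parity a).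
Proof.
move=> an; rewrite (parityE an) -signr_odd mulr_sign.
by case: ifP => // _; apply/(submodN (sym_deg_submod _ _)).
Qed.

Lemma parityK : involutive parity.
Proof.
move=> a; apply: (sym_homogeneous_ind (Y := [set a | parity (parity a) = a])).
  by split=> [|c x y /= px py]; rewrite /= ?raddf0 // linearP /= linearP /= px py.
move=> n {}a an /=; rewrite (parityE (parity_deg an)) (parityE an).
by rewrite mulrA -expr2 sqrr_sign mul1r.
Qed.

End Parity.

Section LinearProjection.
Variables (O : comNzRingType) (E : nat -> lmodType O) (S : symmetric_algebra E).
Variable i : nat.

(* e is the augmentation of S(E) and p its projection to E_i = S^1(E)_i. *)
Definition linear_projection (e : {linear S -> O^o}) (p : {linear S -> E i}) :=
  [/\ (forall j x, e (sym_gen S j x) = 0) /\ (forall a b, e (a * b) = e a * e b),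
      p 1 = 0, forall x, p (sym_gen S i x) = x,
      forall j x, j != i -> p (sym_gen S j x) = 0
    & forall a b, p (a * b) = e a *: p b + e b *: p a].

(** Send [E i] identically to the square-zero part of [trivext] and the other generators to 0. All
    products of images vanish, so the commutation relations hold, and the two components of the
    induced morphism are [e] and [p]. *)
Lemma linear_projection_exists : exists e p, linear_projection e p.
Proof.
pose T := trivext (E i).
have [ins insE] : exists f : forall j, {linear E j -> E i},
    (forall x, f i x = x) /\ (forall j x, j != i -> f j x = 0).
  (* The family must be the identity at [j = i], which typechecks only after a transport along the
     equality of indices. *)
  have h j : {f : {linear E j -> E i} |
      (forall e : j = i, forall x, f x = eq_rect j E x i e)
      /\ (j != i -> forall x, f x = 0)}.
    case: (eqVneq j i) => [->|ne].
      exists idfun; split=> // e x /=.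
      by rewrite (eq_irrelevance e erefl).
    by exists \0; split=> // e; rewrite e eqxx in ne.
  exists (fun j => projT1 (h j)); split=> [x|j x ne].
    by rewrite (projT2 (h i)).1.
  exact: (projT2 (h j)).2.
pose g j (x : E j) : T := (0, ins j x).
have g_lin j : linear (@g j).
  by move=> c x y; rewrite /g linearP; congr (_, _); rewrite /= scaler0 addr0.
pose f j := linmap (g_lin j).
have f_mul j k x y : f j x * f k y = 0.
  by congr (_, _); rewrite /= ?mul0r // !scale0r addr0.
have comm : graded_commuting f by move=> j k x y; rewrite !f_mul mulr0.
have [F [Ff _]] := sym_univ S comm.
have e_lin : linear (fun a => (F a).1 : O^o) by move=> c x y; rewrite linearP.
have p_lin : linear (fun a => (F a).2) by move=> c x y; rewrite linearP.
exists (linmap e_lin), (linmap p_lin); split.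
- by split=> [j x|a b] /=; rewrite ?Ff ?rmorphM.
- by rewrite /= rmorph1.
- by move=> x /=; rewrite Ff /= insE.1.
- by move=> j x ne /=; rewrite Ff /= insE.2.
- by move=> a b /=; rewrite rmorphM.
Qed.

Variables (e : {linear S -> O^o}) (p : {linear S -> E i}).
Hypothesis ep : linear_projection e p.

Lemma aug_degS n a : sym_deg n.+1 a -> e a = 0.
Proof.
have [[eg eM] _ _ _ _] := ep.
apply: (sym_deg_ind (ker_submod e)) => [[|[j x] s] //= _].
by rewrite word_cons eM eg mul0r.
Qed.

Lemma linear_projection_mul a b : e a = 0 -> e b = 0 -> p (a * b) = 0.
Proof. by have [_ _ _ _ pM] := ep => ea eb; rewrite pM ea eb !scale0r addr0. Qed.

Lemma linear_projection_ge2 a : sym_ge2 a -> p a = 0.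
Proof.
have [[eg eM] _ _ _ _] := ep.
apply: (submod_span (ker_submod p)) => _ [[|[j x] [|[k y] s]] //= _ ->].
by rewrite !word_cons linear_projection_mul ?eM ?eg ?mul0r.
Qed.

End LinearProjection.

Section Decomposition.
Variables (O : comNzRingType) (E : nat -> lmodType O) (S : symmetric_algebra E).

Lemma sym_deg_decomposition n (a : S) : sym_deg n.+1 a ->
  exists y, sym_ge2 (a - sym_gen S n.+1 y).
Proof.
pose Y := [set a | exists y, sym_ge2 (a - sym_gen S n.+1 y)].
have s2 := @sym_ge2_submod O E S.
apply: (sym_deg_ind (Y := Y)).
  split=> [|c x y [x' xx'] [y' yy']].
    by exists 0; rewrite raddf0 subr0; apply: submod0.
  exists (c *: x' + y'); rewrite linearP opprD addrACA -scalerBr.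
  exact: s2.2.
(* The empty word has degree 0 and is excluded; a single letter gives [y]; longer words already lie
   in [sym_ge2]. *)
case=> [//|[k x] [|q s]] sn.
  move: sn; rewrite /= addn0 => kn; move: x; rewrite kn => x.
  by exists x; rewrite word1 subrr; apply: submod0.
by exists 0; rewrite raddf0 subr0; apply: span_incl; exists [:: existT E k x, q & s].
Qed.

End Decomposition.

(** * Lifting morphisms out of a Koszul-Tate resolution *)

(** These are the properties of a target that the lifting argument uses, so that one argument serves
    both another resolution and the path algebra. *)
Record dg_algebra (O : comNzRingType) := DgAlgebra {
  dg_alg :> algType O;
  dg_deg : nat -> set dg_alg;
  dg_diff : {linear dg_alg -> dg_alg};
  dg_deg_submod : forall n, submod (dg_deg n);
  dg_deg1 : dg_deg 0 1;
  dg_degM : forall m n a b, dg_deg m a -> dg_deg n b -> dg_deg (m + n) (a * b);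
  dg_deg_comm : forall m n a b, dg_deg m a -> dg_deg n b ->
    a * b = (-1) ^+ (m * n) * (b * a);
  dg_diff1 : dg_diff 1 = 0;
  dg_diffM : forall n a b, dg_deg n a ->
    dg_diff (a * b) = dg_diff a * b + (-1) ^+ n * (a * dg_diff b)
}.

Lemma dg_deg0 (O : comNzRingType) (T : dg_algebra O) n : dg_deg n (0 : T).
Proof. by apply: submod0; apply: dg_deg_submod. Qed.

Lemma kt_diff1 (O : comNzRingType) (I : {pred O}) (R : koszul_tate I) :
  kt_diff R 1 = 0.
Proof. exact/kt_diff_deg0/sym_deg1. Qed.

Definition kt_dga (O : comNzRingType) (I : {pred O}) (R : koszul_tate I) :=
  DgAlgebra (@sym_deg_submod O _ (kt_sym R)) (sym_deg1 _) (@sym_degM _ _ _)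
    (@sym_deg_comm _ _ _) (kt_diff1 R) (@kt_diffM _ _ R).

Section Lifting.
Variables (O : comNzRingType) (I : {pred O}) (R : koszul_tate I).
Variables (T : dg_algebra O) (Q : lmodType O) (p : {linear T -> Q}).
Variable g : forall i, {linear kt_mod R i -> Q}.
Local Notation A := (kt_sym R).
Local Notation d := (kt_diff R).
Local Notation gen := (sym_gen A).
Local Notation D := (@dg_diff O T).

(** The pair [p], [g] imposes side conditions on the lift: none (zero maps) for a morphism between
    resolutions, the two prescribed end points for a path. *)
Definition lifts_to n (G : {lrmorphism A -> T}) :=
  forall j, (j <= n)%N -> forall x : kt_mod R j,
    [/\ dg_deg j (G (gen j x)), D (G (gen j x)) = G (d (gen j x))
      & p (G (gen j x)) = g j x].

(** The letters of a word of degree at most [n] have degree at most [n], so the conditions on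
    generators spread to such words by the Leibniz rule on both sides. *)
Lemma lifts_to_deg n G : lifts_to n G -> forall m a, (m <= n)%N -> sym_deg m a ->
  dg_deg m (G a) /\ D (G a) = G (d a).
Proof.
move=> Gn m a le_mn.
pose Y := [set a | dg_deg m (G a) /\ D (G a) = G (d a)].
apply: (sym_deg_ind (Y := Y)).
  split; first by rewrite /Y /= !raddf0; split=> //; exact: dg_deg0.
  move=> c x y [Gx Dx] [Gy Dy]; rewrite /Y /=; split.
    by rewrite linearP /=; apply: (dg_deg_submod T m).2.
  by rewrite !linearP /= Dx Dy.
rewrite {}/Y /= => s; elim: s m le_mn => [|[i x] s IHs] m le_mn /= sm.
  by rewrite word_nil rmorph1 dg_diff1 kt_diff1 raddf0 -sm; split=> //; exact: dg_deg1.
have [||Gs Ds] := IHs (sumn (map tag s)) => //.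
  by apply: leq_trans le_mn; rewrite -sm leq_addl.
have le_in : (i <= n)%N by apply: leq_trans le_mn; rewrite -sm leq_addr.
have [Gx Dx _] := Gn i le_in x.
rewrite word_cons /= rmorphM /= -sm; split; first exact: dg_degM.
rewrite (dg_diffM _ Gx) (kt_diffM _ (sym_deg_gen _ _)) Dx Ds.
by rewrite rmorphD !rmorphM rmorphXn rmorphN1.
Qed.

Lemma sym_mor_deg_eq n (G G' : {lrmorphism A -> T}) :
  (forall j, (j <= n)%N -> forall x, G (gen j x) = G' (gen j x)) ->
  forall m a, (m <= n)%N -> sym_deg m a -> G a = G' a.
Proof.
move=> GG' m a le_mn; apply: (sym_deg_ind (Y := [set a | G a = G' a])).
  by split=> [|c x y /= Gx Gy]; rewrite /= ?raddf0 // !linearP /= Gx Gy.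
move=> s; elim: s m le_mn => [|[i x] s IHs] m le_mn /= sm.
  by rewrite word_nil !rmorph1.
rewrite word_cons /= !rmorphM /= GG'; last first.
  by apply: leq_trans le_mn; rewrite -sm leq_addr.
rewrite (IHs (sumn (map tag s))) //.
by apply: leq_trans le_mn; rewrite -sm leq_addl.
Qed.

Lemma lifts_to_eq n (G G' : {lrmorphism A -> T}) :
  (forall j, (j <= n)%N -> forall x, G (gen j x) = G' (gen j x)) ->
  lifts_to n G -> lifts_to n G'.
Proof.
move=> GG' Gn [|j] le_jn x; first by rewrite (kt_mod0 x) !raddf0; split=> //;
  exact: dg_deg0.
rewrite -GG' //; have [Gx -> ->] := Gn _ le_jn x; split=> //.
apply: (sym_mor_deg_eq GG' (ltnW le_jn)).
exact/kt_diff_degS/sym_deg_gen.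
Qed.

Hypothesis step : forall n G, lifts_to n G -> forall x : kt_mod R n.+1,
  exists v, [/\ dg_deg n.+1 v, D v = G (d (gen n.+1 x)) & p v = g n.+1 x].

(** The admissible pairs of a generator and a value form a submodule, total by [step], so
    [projective_choice] gives a linear solution in degree [n.+1]. Generators of higher degree are
    provisionally sent to 0. *)
Lemma lift_extend n G : lifts_to n G -> exists G', lifts_to n.+1 G' /\
  forall j, (j <= n)%N -> forall x, G (gen j x) = G' (gen j x).
Proof.
move=> Gn.
pose rel := [set u : kt_mod R n.+1 * T | [/\ dg_deg n.+1 u.2,
  D u.2 = G (d (gen n.+1 u.1)) & p u.2 = g n.+1 u.1]].
have rel_submod : submod rel.
  split; first by rewrite /rel /= !raddf0; split=> //; exact: dg_deg0.
  move=> c [x v] [y w] [/= ? vx vx'] [/= ? wy wy']; rewrite /rel /=; split.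
  - exact: (dg_deg_submod T _).2.
  - by rewrite !linearP /= vx wy.
  - by rewrite !linearP /= vx' wy'.
have [h hP] := projective_choice rel_submod (@kt_proj _ _ R _ (ltn0Sn n)) (step Gn).
have f0 j : {f : {linear kt_mod R j -> T} | [/\
    (forall e : j = n.+1, forall x, f x = h (eq_rect j (kt_mod R) x _ e)),
    ((j <= n)%N -> forall x, f x = G (gen j x)) &
    ((n.+1 < j)%N -> forall x, f x = 0)]}.
  case: (eqVneq j n.+1) => [->|ne].
    exists h; split=> [e x|lt|lt]; last by rewrite ltnn in lt.
      by rewrite (eq_irrelevance e erefl).
    by rewrite ltnn in lt.
  case: (leqP j n) => [le|lt].
    exists (G \o gen j); split=> // [e|lt]; first by rewrite e eqxx in ne.
    by have := leq_trans lt le; rewrite ltnNge leqnSn.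
  by exists \0; split=> // e; rewrite e eqxx in ne.
pose f j := projT1 (f0 j).
have f_le j x : (j <= n)%N -> f j x = G (gen j x).
  by move=> le; have [_ -> ] := projT2 (f0 j).
have f_eq x : f n.+1 x = h x by have [-> // _ _] := projT2 (f0 n.+1).
have f_deg j x : dg_deg j (f j x).
  case: (ltngtP j n.+1) => [lt|gt|e].
  - by rewrite f_le //; have [] := Gn j lt x.
  - have [_ _ ->] := projT2 (f0 j) => //; exact: dg_deg0.
  - by move: x; rewrite e => x; rewrite f_eq; have [] := hP x.
have comm : graded_commuting f by move=> j k x y; apply: dg_deg_comm.
have [G' [G'f _]] := sym_univ A comm.
have GG' j : (j <= n)%N -> forall x, G (gen j x) = G' (gen j x).
  by move=> le x; rewrite G'f f_le.
exists G'; split=> // j; rewrite leq_eqVlt => /orP[/eqP -> x|lt].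
  have [h1 h2 h3] := hP x; rewrite G'f f_eq; split=> //.
  rewrite h2; apply: (sym_mor_deg_eq GG' (leqnn n)).
  exact/kt_diff_degS/sym_deg_gen.
exact: (lifts_to_eq GG' Gn).
Qed.

(** Consecutive stages agree on the generators already treated, so the limit can be read off
    diagonally: its value on degree [j] is that of stage [j]. *)
Lemma lift_exists : exists G, forall n, lifts_to n G.
Proof.
have G0 : exists G, lifts_to 0 G.
  have comm : graded_commuting (fun i => \0 : {linear kt_mod R i -> T}).
    by move=> i j x y /=; rewrite !mul0r mulr0.
  have [G _] := sym_univ A comm; exists G => j; rewrite leqn0 => /eqP -> x.
  rewrite (kt_mod0 x) !raddf0; split=> //; exact: dg_deg0.
(* Each stage carries its proof of [lifts_to], since choosing the next one requires it. *)
pose Gs : forall n, {G | lifts_to n G} := fix Gs n :=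
  if n is m.+1 then
    let G' := cid (lift_extend (projT2 (Gs m))) in
    exist _ (projT1 G') (projT2 G').1
  else exist _ (projT1 (cid G0)) (projT2 (cid G0)).
have GsS n j x : (j <= n)%N ->
    projT1 (Gs n) (gen j x) = projT1 (Gs n.+1) (gen j x).
  by move=> le /=; case: (cid _) => G' [? /= ->].
have Gs_eq n j x : (j <= n)%N ->
    projT1 (Gs n) (gen j x) = projT1 (Gs j) (gen j x).
  elim: n j x => [|n IHn] j x; first by rewrite leqn0 => /eqP ej; move: x; rewrite ej.
  rewrite leq_eqVlt => /orP[/eqP ej|le]; first by move: x; rewrite ej.
  by rewrite -GsS // IHn.
pose f j : {linear kt_mod R j -> T} := projT1 (Gs j) \o gen j.
have comm : graded_commuting f.
  move=> j k x y; apply: dg_deg_comm.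
    by have [] := projT2 (Gs j) j (leqnn j) x.
  by have [] := projT2 (Gs k) k (leqnn k) y.
have [G [Gf _]] := sym_univ A comm.
exists G => n; apply: lifts_to_eq (projT2 (Gs n)) => j le x.
by rewrite Gf Gs_eq.
Qed.

Lemma lift_deg (G : {lrmorphism A -> T}) : (forall n, lifts_to n G) ->
  (forall n a, sym_deg n a -> dg_deg n (G a)) /\ forall a, D (G a) = G (d a).
Proof.
move=> GP; split=> [n a an|]; first by have [] := lifts_to_deg (GP n) (leqnn n) an.
apply: sym_homogeneous_ind => [|n a an]; last first.
  by have [] := lifts_to_deg (GP n) (leqnn n) an.
by split=> [|c x y /= Gx Gy]; rewrite /= ?raddf0 // !linearP /= Gx Gy.
Qed.

End Lifting.

(** * The path algebra *)

Section PathAlgebra.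
Variables (O : comNzRingType) (B : algType O) (sigma : {lrmorphism B -> B}).
Local Notation "p ^s" := (map_poly sigma p) (at level 2, format "p ^s").

(* The pair (p, q) stands for p + q dt in B[t] + B[t] dt, where moving dt past
   an element of B applies sigma to it. *)
Definition path_alg of {lrmorphism B -> B} := ({poly B} * {poly B})%type.
Local Notation P := (path_alg sigma).
HB.instance Definition _ := GRing.Zmodule.on P.

(** Polynomials form a module over [B], so a scalar of [O] acts through its image in [B]. *)
Definition path_scale (a : O) (u : P) : P := (a%:A *: u.1, a%:A *: u.2).

Fact path_scaleA a b u : path_scale a (path_scale b u) = path_scale (a * b) u.
Proof. by rewrite /path_scale /= !scalerA -scalerAl mul1r scalerA. Qed.

Fact path_scale1 : left_id 1 path_scale.
Proof. by case=> p q; rewrite /path_scale /= !scale1r. Qed.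

Fact path_scaleDr : right_distributive path_scale +%R.
Proof. by move=> a u v; rewrite /path_scale /= !scalerDr. Qed.

Fact path_scaleDl u : {morph path_scale^~ u : a b / a + b}.
Proof. by move=> a b; rewrite /path_scale /= !scalerDl. Qed.

HB.instance Definition _ := GRing.Zmodule_isLmodule.Build O P path_scaleA
  path_scale1 path_scaleDr path_scaleDl.

(** Expansion of (p + q dt)(p' + q' dt) with dt dt = 0 and dt p' = sigma(p') dt. *)
Definition path_mul (u v : P) : P := (u.1 * v.1, u.1 * v.2 + u.2 * v.1^s).
Definition path_one : P := (1, 0).

Fact path_mulA : associative path_mul.
Proof.
case=> [p q] [p' q'] [r s]; rewrite /path_mul /= mulrA; congr (_, _).
by rewrite mulrDr mulrDl !mulrA rmorphM /= mulrA addrA.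
Qed.

Fact path_mul1r : left_id path_one path_mul.
Proof. by case=> p q; rewrite /path_mul /= !mul1r mul0r addr0. Qed.

Fact path_mulr1 : right_id path_one path_mul.
Proof. by case=> p q; rewrite /path_mul /= rmorph1 !mulr1 mulr0 add0r. Qed.

Fact path_mulDl : left_distributive path_mul +%R.
Proof.
case=> [p q] [p' q'] [r s]; rewrite /path_mul /= mulrDl; congr (_, _).
by rewrite /= !mulrDl addrACA.
Qed.

Fact path_mulDr : right_distributive path_mul +%R.
Proof.
case=> [r s] [p q] [p' q']; rewrite /path_mul /= mulrDr; congr (_, _).
by rewrite /= rmorphD !mulrDr addrACA.
Qed.

Fact path_one_neq0 : path_one != 0.
Proof. by rewrite /eq_op /= oner_eq0. Qed.

HB.instance Definition _ := GRing.Zmodule_isNzRing.Build P path_mulA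
  path_mul1r path_mulr1 path_mulDl path_mulDr path_one_neq0.

Lemma poly_scaleAr (a : O) (p q : {poly B}) : p * (a%:A *: q) = a%:A *: (p * q).
Proof.
apply/polyP => i; rewrite coefZ !coefM mulr_sumr; apply: eq_bigr => j _.
by rewrite coefZ -!scalerAl !mul1r scalerAr.
Qed.

Lemma map_poly_scale (a : O) (f : {linear B -> B}) (p : {poly B}) :
  map_poly f (a%:A *: p) = a%:A *: map_poly f p.
Proof.
apply/polyP => i; rewrite coefZ !coef_map coefZ.
by rewrite -!scalerAl !mul1r; apply: linearZ.
Qed.

Fact path_scaleAl (a : O) (u v : P) : a *: (u * v) = (a *: u) * v.
Proof.
case: u v => [p q] [p' q']; congr (_, _); first by rewrite /= scalerAl.
by rewrite /= scalerDr !scalerAl.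
Qed.

HB.instance Definition _ := GRing.Lmodule_isLalgebra.Build O P path_scaleAl.

Fact path_scaleAr (a : O) (u v : P) : a *: (u * v) = u * (a *: v).
Proof.
case: u v => [p q] [p' q']; congr (_, _); first by rewrite /= poly_scaleAr.
by rewrite /= scalerDr map_poly_scale !poly_scaleAr.
Qed.

HB.instance Definition _ := GRing.Lalgebra_isAlgebra.Build O P path_scaleAr.

Lemma path_scaleE (a : O) (u : P) : a *: u = (a%:A *: u.1, a%:A *: u.2).
Proof. by []. Qed.

Lemma path_mulE (u v : P) : u * v = (u.1 * v.1, u.1 * v.2 + u.2 * v.1^s).
Proof. by []. Qed.

Lemma path_addE (u v : P) : u + v = (u.1 + v.1, u.2 + v.2).
Proof. by []. Qed.

Lemma path_signE (k : nat) (u : P) :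
  (-1) ^+ k * u = ((-1) ^+ k * u.1, (-1) ^+ k * u.2).
Proof. by rewrite -!(signr_odd _ k) !mulr_sign; case: u => p q; case: odd. Qed.

End PathAlgebra.

Lemma coef_sign (B : nzRingType) (k : nat) (p : {poly B}) i :
  ((-1) ^+ k * p)`_i = (-1) ^+ k * p`_i.
Proof. by rewrite -!(signr_odd _ k) !mulr_sign; case: odd; rewrite ?coefN. Qed.

Lemma coef_map_linear (O : comNzRingType) (B : algType O) (f : {linear B -> B})
  (p : {poly B}) i : (map_poly f p)`_i = f p`_i.
Proof. exact: coef_map. Qed.

Section GradedPolynomials.
Variables (O : comNzRingType) (I : {pred O}) (R : koszul_tate I).
Local Notation B := (kt_sym R).
Local Notation d := (kt_diff R).

Definition poly_deg n (p : {poly B}) := forall k, sym_deg n p`_k.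

Let degS n := @sym_deg_submod _ _ B n.

Lemma poly_deg0 n : poly_deg n 0.
Proof. by move=> k; rewrite coef0; exact: (submod0 (degS n)). Qed.

Lemma poly_degD n p q : poly_deg n p -> poly_deg n q -> poly_deg n (p + q).
Proof. by move=> pn qn k; rewrite coefD; apply: (submodD (degS n)). Qed.

Lemma poly_degM m n p q : poly_deg m p -> poly_deg n q -> poly_deg (m + n) (p * q).
Proof.
move=> pn qn k; rewrite coefM; apply: (submod_sum (degS _)) => i _.
exact: sym_degM.
Qed.

Lemma poly_deg_comm m n p q : poly_deg m p -> poly_deg n q ->
  p * q = (-1) ^+ (m * n) * (q * p).
Proof.
move=> pm qn; apply/polyP => k; rewrite coef_sign coefM coefMr mulr_sumr.
by apply: eq_bigr => i _; apply: sym_deg_comm.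
Qed.

Lemma poly_deg_parity n p : poly_deg n p ->
  map_poly (parity B) p = (-1) ^+ n * p.
Proof.
move=> pn; apply/polyP => k; rewrite coef_map_linear coef_sign.
exact: parityE.
Qed.

Lemma map_parityK p : map_poly (parity B) (map_poly (parity B) p) = p.
Proof. by apply/polyP => k; rewrite !coef_map_linear; apply: parityK. Qed.

(** The differential changes the degree by one, hence anticommutes with the sign of the degree. *)
Lemma kt_diff_parity a : d (parity B a) = - parity B (d a).
Proof.
apply: (sym_homogeneous_ind (Y := [set a | d (parity B a) = - parity B (d a)])).
  split=> [|c x y /= dx dy]; rewrite /= ?raddf0 ?oppr0 //.
  by rewrite !linearP /= dx dy scalerN.
move=> [|n] {}a an /=.
  by rewrite (parityE an) mul1r kt_diff_deg0 // raddf0 oppr0.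
rewrite (parityE an) (parityE (kt_diff_degS an)) exprS mulN1r mulNr.
by rewrite -!(signr_odd _ n) !mulr_sign; case: odd; rewrite ?opprK ?raddfN.
Qed.

Lemma poly_diffM n p q : poly_deg n p ->
  map_poly d (p * q) = map_poly d p * q + (-1) ^+ n * (p * map_poly d q).
Proof.
move=> pn; apply/polyP => k; rewrite coef_map_linear coefD coef_sign !coefM.
rewrite raddf_sum mulr_sumr -big_split; apply: eq_bigr => i _ /=.
by rewrite (kt_diffM _ (pn i)) !coef_map_linear.
Qed.

Lemma map_diff_parity p :
  map_poly d (map_poly (parity B) p) = - map_poly (parity B) (map_poly d p).
Proof.
by apply/polyP => k; rewrite coefN !coef_map_linear; apply: kt_diff_parity.
Qed.

Lemma poly_deg_parity_deg n p : poly_deg n p -> poly_deg n (map_poly (parity B) p).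
Proof. by move=> pn k; rewrite coef_map_linear; apply: parity_deg. Qed.

Lemma poly_degZ n c p : poly_deg n p -> poly_deg n (c%:A *: p).
Proof.
move=> pn k; rewrite coefZ -scalerAl mul1r; exact: (submodZ (degS n)).
Qed.

Lemma deriv_map_linear (f : {linear B -> B}) (p : {poly B}) :
  (map_poly f p)^`() = map_poly f p^`().
Proof.
by apply/polyP => k; rewrite coef_map_linear !coef_deriv coef_map_linear raddfMn.
Qed.

End GradedPolynomials.

Lemma mulr_signCA (B : pzRingType) (k : nat) (x y : B) :
  x * ((-1) ^+ k * y) = (-1) ^+ k * (x * y).
Proof. by rewrite mulrA (commr_sign x k) mulrA. Qed.

Section PathDga.
Variables (O : comNzRingType) (I : {pred O}) (R : koszul_tate I).
Local Notation B := (kt_sym R).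
Local Notation d := (kt_diff R).
Local Notation P := (path_alg (parity B)).
Local Notation "p ^s" := (map_poly (parity B) p) (at level 2, format "p ^s").

(** Differentials lower degrees, so dt has degree -1 and its coefficient has degree [n.+1]. *)
Definition path_deg n : set P := [set u | poly_deg n u.1 /\ poly_deg n.+1 u.2].

(** The de Rham term is dt times the derivative in t; writing dt on the right turns it into the
    parity of that derivative. *)
Definition path_diff_fun (u : P) : P :=
  (map_poly d u.1, map_poly d u.2 + (u.1^`())^s).

Fact path_diff_linear : linear path_diff_fun.
Proof.
move=> c u v; rewrite /path_diff_fun path_addE path_scaleE /=.
congr (_, _); first by rewrite raddfD /= map_poly_scale.
rewrite /= !raddfD /= derivZ !map_poly_scale; exact: addrACA.
Qed.

Definition path_diff : {linear P -> P} := linmap path_diff_linear.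

Fact path_deg_submod n : submod (path_deg n).
Proof.
split=> [|c u v [u1 u2] [v1 v2]]; first by split; apply: poly_deg0.
by split; apply: poly_degD => //; apply: poly_degZ.
Qed.

Fact path_deg1 : path_deg 0 1.
Proof.
split=> [k /=|]; last exact: poly_deg0.
rewrite coef1; case: eqP => _; first exact: sym_deg1.
by apply: submod0; apply: sym_deg_submod.
Qed.

Fact path_degM m n u v : path_deg m u -> path_deg n v -> path_deg (m + n) (u * v).
Proof.
move=> [u1 u2] [v1 v2]; split=> /=; first exact: poly_degM.
apply: poly_degD; first by rewrite -addnS; apply: poly_degM.
by rewrite -addSn; apply: poly_degM => //; apply: poly_deg_parity_deg.
Qed.

Fact path_deg_comm m n u v : path_deg m u -> path_deg n v ->
  u * v = (-1) ^+ (m * n) * (v * u).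
Proof.
move=> [u1 u2] [v1 v2].
rewrite path_signE !path_mulE /=; congr (_, _); first exact: poly_deg_comm.
rewrite (poly_deg_parity u1) (poly_deg_parity v1).
rewrite !mulr_signCA (poly_deg_comm u1 v2) (poly_deg_comm u2 v1).
rewrite mulSn mulnS !exprD mulrDr -!mulrA addrC; congr (_ + _).
  by rewrite mulrA -expr2 sqrr_sign mul1r.
exact: mulr_signCA.
Qed.

Fact path_diff1 : path_diff 1 = 0.
Proof.
rewrite /path_diff /= /path_diff_fun /=; congr (_, _); last first.
  by rewrite derivC !raddf0 addr0.
apply/polyP => k; rewrite coef_map_linear coef1 coef0.
by case: eqP => _; rewrite ?raddf0 ?kt_diff1.
Qed.

Fact path_diffM n u v : path_deg n u ->
  path_diff (u * v) = path_diff u * v + (-1) ^+ n * (u * path_diff v).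
Proof.
move=> [u1 u2].
rewrite path_signE path_addE !path_mulE /= /path_diff_fun /=; congr (_, _).
  exact: poly_diffM.
have sD p q : (p + q)^s = p^s + q^s by rewrite rmorphD.
have sM p q : (p * q)^s = p^s * q^s by rewrite rmorphM.
rewrite raddfD /= (poly_diffM _ u1) (poly_diffM _ u2) derivM sD !sM.
(* The extra sign due to [u.2] having degree [n.+1] cancels the one from the differential
   anticommuting with parity. *)
rewrite map_diff_parity (poly_deg_parity u1) exprS !mulrN mulN1r mulNr opprK.
rewrite !mulrDr mulrDl -[(-1) ^+ n * u.1 * _]mulrA.
set a1 := map_poly d u.1 * _; set a2 := _ * (_ * map_poly d v.2).
set a3 := map_poly d u.2 * _; set a4 := _ * (u.2 * _).
set a5 := _^s * _^s; set a6 := _ * (_ * (v.1^`())^s).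
rewrite -!addrA; congr (_ + _).
rewrite addrCA; congr (_ + _).
rewrite [RHS]addrCA; congr (_ + _).
by rewrite addrCA [a4 + a6]addrC.
Qed.

Definition path_dga : dg_algebra O :=
  DgAlgebra path_deg_submod path_deg1 path_degM path_deg_comm path_diff1
    path_diffM.

Fact path_eval_linear (c : B) : linear (fun u : P => u.1.[c]).
Proof. by move=> a u v /=; rewrite hornerD hornerZ -scalerAl mul1r. Qed.

(** [B] is not commutative, but 0 and 1 commute with all coefficients, which makes evaluation at
    either end multiplicative. A boolean encodes the end. *)
Lemma comm_poly_bool (b : bool) (p : {poly B}) : comm_poly p b%:R.
Proof. by apply: comm_coef_poly => k; case: b; [apply: commr1 | apply: commr0]. Qed.

Fact path_eval_mor (b : bool) : monoid_morphism (fun u : P => u.1.[b%:R]).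
Proof.
split=> [|u v] /=; first by rewrite hornerC.
by rewrite hornerM_comm //; apply: comm_poly_bool.
Qed.

Definition path_eval_lrmap (b : bool) : {lrmorphism P -> B} :=
  lrmap (path_eval_linear b%:R) (path_eval_mor b).

Lemma horner1_wide n (p : {poly B}) : (size p <= n)%N -> p.[1] = \sum_(i < n) p`_i.
Proof.
move=> le_pn; rewrite (horner_coef_wide _ le_pn).
by apply: eq_bigr => i _; rewrite expr1n mulr1.
Qed.

Lemma horner1_map (f : {linear B -> B}) p : (map_poly f p).[1] = f p.[1].
Proof.
rewrite (horner1_wide (leqnn (size p))) raddf_sum (@horner1_wide (size p)).
  by apply: eq_bigr => i _; rewrite coef_map_linear.
exact: size_poly.
Qed.

Lemma horner1_deg n (p : {poly B}) : poly_deg n p -> sym_deg n p.[1].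
Proof.
move=> pn; rewrite (horner1_wide (leqnn (size p))).
by apply: submod_sum; [apply: sym_deg_submod|move=> i _; apply: pn].
Qed.

End PathDga.

(** * Integration in t and lifting of morphisms to paths *)

Section Integration.
Variables (K : fieldType) (char0 : [pchar K] =i pred0) (O : comAlgType K).
Variables (B : algType O).

(* The integral from 0; its constant coefficient vanishes because 0^-1 = 0. *)
Definition poly_int (p : {poly B}) : {poly B} :=
  \poly_(k < (size p).+1) ((k%:R^-1 : K)%:A *: p`_k.-1).

Lemma coef_int p k : (poly_int p)`_k = (k%:R^-1 : K)%:A *: p`_k.-1.
Proof.
rewrite coef_poly; case: ltnP => //; case: k => // k le_pk.
by rewrite /= nth_default ?scaler0.
Qed.

Lemma coef_int0 p : (poly_int p)`_0 = 0.
Proof. by rewrite coef_int invr0 !scale0r. Qed.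

Lemma natr_inv_alg n : n.+1%:R * (n.+1%:R^-1 : K)%:A = 1 :> O.
Proof.
rewrite mulr_algr -scaler_nat scalerA mulrC divff ?scale1r //.
by have /pcharf0P -> := char0.
Qed.

Lemma deriv_int p : (poly_int p)^`() = p.
Proof.
apply/polyP => k; rewrite coef_deriv coef_int -scaler_nat scalerA.
by rewrite natr_inv_alg scale1r.
Qed.

Lemma int_deriv p : poly_int p^`() = p - (p`_0)%:P.
Proof.
apply/polyP => [[|k]]; first by rewrite coef_int0 coefB coefC subrr.
rewrite coef_int coefB coefC subr0 coef_deriv -scaler_nat scalerA mulrC.
by rewrite natr_inv_alg scale1r.
Qed.

Lemma int_map (f : {linear B -> B}) p :
  poly_int (map_poly f p) = map_poly f (poly_int p).
Proof.
apply/polyP => k; rewrite coef_map_linear !coef_int coef_map_linear.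
by rewrite linearZ.
Qed.

Lemma intN p : poly_int (- p) = - poly_int p.
Proof. by apply/polyP => k; rewrite coefN !coef_int coefN scalerN. Qed.

Lemma int_linear c p q : poly_int (c%:A *: p + q) = c%:A *: poly_int p + poly_int q.
Proof.
apply/polyP => k; rewrite coefD coefZ !coef_int coefD coefZ scalerDr.
by rewrite -!scalerAl !mul1r !scalerA mulrC.
Qed.

End Integration.

Section Homotopy.
Variables (K : fieldType) (char0 : [pchar K] =i pred0) (O : comAlgType K).
Variables (I : {pred O}) (R : koszul_tate I).
Local Notation B := (kt_sym R).
Local Notation d := (kt_diff R).
Local Notation gen := (sym_gen B).
Local Notation P := (path_alg (parity B)).
Local Notation "p ^s" := (map_poly (parity B) p) (at level 2, format "p ^s").
Local Notation int := (@poly_int K O B).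

Lemma int_deg n (p : {poly B}) : poly_deg n p -> poly_deg n (int p).
Proof.
by move=> pn k; rewrite coef_int; apply: submodZ; first exact: sym_deg_submod.
Qed.

(* Surjectivity and acyclicity of the kernel of the evaluations at the two end
   points, in the only form that the lifting argument needs. *)
Lemma path_acyclic n (w : P) b0 b1 :
  path_deg n w -> path_diff R w = 0 -> sym_deg n.+1 b0 -> sym_deg n.+1 b1 ->
  d b0 = w.1.[0] -> d b1 = w.1.[1] ->
  exists v, [/\ path_deg n.+1 v, path_diff R v = w, v.1.[0] = b0 & v.1.[1] = b1].
Proof.
case: w => p q [/= pn qn] [dp dq] b0n b1n db0 db1.
have sK : involutive (map_poly (parity B)) by apply: map_parityK.
(* A first solution without dt-part: the dt-part of its differential must be [q], which fixes the
   derivative of [r], and the value at 0 fixes the constant. Its value at 1 may still be wrong. *)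
pose r := b0%:P + (int q)^s.
have r_deg : poly_deg n.+1 r.
  apply: poly_degD; last exact/poly_deg_parity_deg/int_deg.
  move=> k; rewrite coefC; case: eqP => // _.
  by apply: submod0; apply: sym_deg_submod.
have dr : map_poly d r = p.
  rewrite raddfD /= map_polyC /= db0 map_diff_parity -int_map -int_map.
  have -> : (map_poly d q)^s = - p^`().
    by move/eqP: dq; rewrite addr_eq0 => /eqP ->; rewrite raddfN /= sK.
  by rewrite intN opprK int_deriv // horner_coef0 addrC subrK.
have dr1 : d r.[1] = d b1 by rewrite -horner1_map dr.
(* The error at 1 is a cycle of positive degree, hence a boundary. *)
have [||rho rho_deg drho] := @kt_exact _ _ R n (b1 - r.[1]).
- apply: (submodB (@sym_deg_submod _ _ B _)) => //; exact: horner1_deg.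
- by rewrite raddfB /= dr1 subrr.
(* The correction is the path differential of rho t: it is closed, vanishes at 0 and equals [d rho],
   the missing error, at 1. *)
exists (r + (d rho)%:P * 'X, (parity B rho)%:P); split.
- split=> /=.
    apply: poly_degD => // k; rewrite coefMX coefC.
    case: ifP => _; first by apply: submod0; apply: sym_deg_submod.
    case: ifP => _; last by apply: submod0; apply: sym_deg_submod.
    exact: kt_diff_degS.
  move=> k; rewrite coefC; case: eqP => _; first exact: parity_deg.
  by apply: submod0; apply: sym_deg_submod.
- rewrite /path_diff /= /path_diff_fun /=; congr (_, _).
    rewrite raddfD /= dr -[RHS]addr0; congr (_ + _).
    apply/polyP => k; rewrite coef_map_linear coef0 coefMX coefC.
    by case: ifP => _; [|case: ifP => _]; rewrite ?raddf0 ?kt_diffK.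
  rewrite map_polyC /= derivD derivM derivC mul0r add0r derivX mulr1.
  rewrite /r derivD derivC add0r deriv_map_linear deriv_int // raddfD /= sK.
  by rewrite map_polyC /= kt_diff_parity polyCN addrCA addNr addr0.
- rewrite /= hornerD hornerMX mulr0 addr0 /r hornerD hornerC horner_coef0.
  by rewrite coef_map_linear coef_int0 raddf0 addr0.
- by rewrite /= hornerD hornerMX hornerC mulr1 drho addrC subrK.
Qed.

Section HomotopyOfMorphisms.
Variable chi : {lrmorphism B -> B}.
Hypothesis chi_deg : forall n a, sym_deg n a -> sym_deg n (chi a).
Hypothesis chi_diff : forall a, d (chi a) = chi (d a).

Lemma path_lift_exists : exists G : {lrmorphism B -> P},
  [/\ forall n a, sym_deg n a -> path_deg n (G a),
      forall a, path_diff R (G a) = G (d a),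
      forall a, (G a).1.[0] = chi a & forall a, (G a).1.[1] = a].
Proof.
pose Q := (B * B)%type.
have p_lin : linear (fun u : path_dga R => (u.1.[0], u.1.[1]) : Q).
  by move=> c u v; congr (_, _); apply: path_eval_linear.
have g_lin i : linear (fun x => (chi (gen i x), gen i x) : Q).
  by move=> c x y; congr (_, _); rewrite !linearP.
have step n (G : {lrmorphism B -> path_dga R}) :
    lifts_to (linmap p_lin) (fun i => linmap (g_lin i)) n G ->
    forall x : kt_mod R n.+1, exists v : path_dga R, [/\ dg_deg n.+1 v,
      dg_diff _ v = G (d (gen n.+1 x)) & linmap p_lin v = linmap (g_lin n.+1) x].
  move=> Gn x; have dx := kt_diff_degS (sym_deg_gen B x).
  have [Gdx DGdx] := lifts_to_deg Gn (leqnn n) dx.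
  (* The differential of a generator of degree [n.+1] has degree [n], where the end points of [G]
     are already determined by the generators treated so far. *)
  have ends (b : bool) (F : {lrmorphism B -> B}) :
      (forall j, (j <= n)%N -> forall x, (G (gen j x)).1.[b%:R] = F (gen j x)) ->
      (G (d (gen n.+1 x))).1.[b%:R] = F (d (gen n.+1 x)).
    move=> GF; pose Gb : {lrmorphism B -> B} := path_eval_lrmap R b \o G.
    exact: (@sym_mor_deg_eq _ _ R (kt_dga R) n Gb F GF n _ (leqnn n) dx).
  have [|||||v [v1 v2 v3 v4]] := @path_acyclic n (G (d (gen n.+1 x)))
    (chi (gen n.+1 x)) (gen n.+1 x) Gdx.
  - by rewrite DGdx kt_diffK raddf0.
  - exact/chi_deg/sym_deg_gen.
  - exact: sym_deg_gen.
  - rewrite chi_diff (ends false chi) // => j le y.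
    by have [_ _ []] := Gn j le y.
  - rewrite (ends true idfun) // => j le y.
    by have [_ _ []] := Gn j le y.
  by exists v; split=> //; rewrite /= v3 v4.
have [G GP] := lift_exists step.
have [Gdeg Gdiff] := lift_deg GP.
have ends (b : bool) (F : {lrmorphism B -> B}) :
    (forall j x, (G (gen j x)).1.[b%:R] = F (gen j x)) ->
    forall a, (G a).1.[b%:R] = F a.
  move=> GF; pose Gb : {lrmorphism B -> B} := path_eval_lrmap R b \o G.
  exact: (@sym_mor_ext _ _ _ _ Gb F).
exists G; split=> //.
  by apply: (ends false) => j x; have [_ _ []] := GP j j (leqnn j) x.
by apply: (ends true idfun) => j x; have [_ _ []] := GP j j (leqnn j) x.
Qed.

End HomotopyOfMorphisms.

End Homotopy.

(** * Reduced complexes *)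

Section Augmentation.
Variables (O : comNzRingType) (I : {pred O}) (R : koszul_tate I).
Local Notation B := (kt_sym R).
Local Notation d := (kt_diff R).
Local Notation gen := (sym_gen B).

Lemma kt_word_deg_gt0 s : (0 < size s)%N ->
  word B s = 0 \/ (0 < sumn (map tag s))%N.
Proof.
case: s => [//|[[|i] x] s _]; last by right.
by left; rewrite word_cons /= (kt_mod0 x) raddf0 mul0r.
Qed.

Lemma kt_deg0_scalar (a : B) : sym_deg 0 a -> exists c, a = c%:A.
Proof.
apply: (sym_deg_ind (Y := [set a : B | exists c : O, a = c%:A])).
  split=> [|c x y [c1 ->] [c2 ->]]; first by exists 0; rewrite scale0r.
  by exists (c * c1 + c2); rewrite scalerDl scalerA.
move=> s s0; case: (posnP (size s)) => [/size0nil ->|sz].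
  by exists 1; rewrite word_nil scale1r.
have [->|] := kt_word_deg_gt0 sz; first by exists 0; rewrite scale0r.
by rewrite s0.
Qed.

Variables (i : nat) (e : {linear B -> O^o}) (p : {linear B -> kt_mod R i}).
Hypothesis ep : linear_projection e p.

Lemma kt_aug_word s : (0 < size s)%N -> e (word B s) = 0.
Proof.
move=> /kt_word_deg_gt0[->|s_gt0]; first exact: raddf0.
have := sym_deg_word B s; case: (sumn _) s_gt0 => // n _; exact: aug_degS ep _ _.
Qed.

(** Only degree 1 contributes: there the differential is a scalar of [I]. In degree 0 it vanishes,
    and above degree 1 its value has positive degree and is killed by [e]. *)
Lemma kt_aug_diff (J : {pred O}) (idealJ : idealr_closed J)
  (subIJ : {subset I <= J}) n (a : B) : sym_deg n a -> e (d a) \in J.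
Proof.
have [J0 _ JM] := idealJ; have e0 : e 0 \in J by rewrite raddf0.
case: n => [|[|n]] an; first by rewrite kt_diff_deg0.
  have [c dac] := kt_deg0_scalar (kt_diff_degS an).
  have Ic : c \in I by apply/kt_H0; exists a.
  rewrite dac linearZ /= [_ *: _]mulrC -[_ * _]addr0; apply: JM => //.
  exact: subIJ.
by rewrite (aug_degS ep (kt_diff_degS an)).
Qed.

(* The terms outside S^{>=2}(E) come from the differential of E_1, which takes its
   values in I. *)
Lemma linear_projection_diff_ge2 (J : {pred O}) (idealJ : idealr_closed J)
  (subIJ : {subset I <= J}) (a : B) : sym_ge2 a -> ideal_smul J (p (d a)).
Proof.
have sJ := @ideal_smul_submod O (kt_mod R i) J.
have [[eg _] _ _ _ pM] := ep.
apply: (submod_span (Y := [set a | ideal_smul J (p (d a))])).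
  exact: (preim_submod (p \o d) sJ).
move=> _ [[|[j x] s] // s_gt0 ->]; rewrite /= word_cons /=.
rewrite (kt_diffM _ (sym_deg_gen _ _)) raddfD /=.
have es : e (word B s) = 0 by apply: kt_aug_word.
apply: (submodD sJ).
  rewrite pM es scale0r addr0; apply: ideal_smulZ.
  exact: (kt_aug_diff idealJ subIJ (sym_deg_gen B x)).
rewrite -signr_odd mulr_sign; case: odd; rewrite ?raddfN /=;
  [apply: (submodN sJ)|]; rewrite pM eg scale0r add0r;
  apply: ideal_smulZ; exact: (kt_aug_diff idealJ subIJ (sym_deg_word B s)).
Qed.

End Augmentation.

(** * Comparison of two resolutions and the induced homotopy *)

Section Comparison.
Variables (O : comNzRingType) (I : {pred O}).

Lemma kt_morphism_exists (R R' : koszul_tate I) :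
  exists phi : {lrmorphism kt_sym R -> kt_sym R'},
    (forall n a, sym_deg n a -> sym_deg n (phi a)) /\
    (forall a, kt_diff R' (phi a) = phi (kt_diff R a)).
Proof.
have step n (G : {lrmorphism kt_sym R -> kt_dga R'}) :
    lifts_to (\0 : {linear _ -> O^o}) (fun i => \0 : {linear _ -> O^o}) n G ->
    forall x : kt_mod R n.+1, exists v : kt_dga R', [/\ dg_deg n.+1 v,
      dg_diff _ v = G (kt_diff R (sym_gen (kt_sym R) n.+1 x)) & 0 = 0 :> O^o].
  move=> Gn x; have dx := kt_diff_degS (sym_deg_gen (kt_sym R) x).
  have [Gdx DGdx] := lifts_to_deg Gn (leqnn n) dx.
  rewrite kt_diffK raddf0 in DGdx.
  (* On [E_1] the lift exists because both resolutions have the same ideal [I] as image in degree 0;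
     above, by exactness of [R']. *)
  case: n => [|n] in G Gn x dx Gdx DGdx *.
    have [c dxc] := kt_deg0_scalar dx.
    have Ic : c \in I.
      by apply/(kt_H0 R c); exists (sym_gen (kt_sym R) 1 x) => //; apply: sym_deg_gen.
    have [b b1 db] := (kt_H0 R' c).1 Ic.
    by exists b; split; rewrite // dxc linearZ /= rmorph1.
  by have [b bn db] := kt_exact Gdx DGdx; exists b; split.
have [phi phiP] := lift_exists step.
by exists phi; have [] := lift_deg phiP.
Qed.

(** [phi] preserves degrees, so a word of length at least 2 becomes a product of two elements with
    zero augmentation, on which [p] vanishes. *)
Lemma linear_projection_morphism_ge2 (R R' : koszul_tate I) i
  (e : {linear kt_sym R' -> O^o}) (p : {linear kt_sym R' -> kt_mod R' i})
  (phi : {lrmorphism kt_sym R -> kt_sym R'}) :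
  linear_projection e p -> (forall n a, sym_deg n a -> sym_deg n (phi a)) ->
  forall a, sym_ge2 a -> p (phi a) = 0.
Proof.
move=> ep phi_deg; have [[eg eM] _ _ _ pM] := ep.
have ephi (s : seq {j : nat & kt_mod R j}) :
    (0 < size s)%N -> e (phi (word (kt_sym R) s)) = 0.
  move=> /kt_word_deg_gt0[->|]; first by rewrite !raddf0.
  have := sym_deg_word (kt_sym R) s; case: (sumn _) => // n sn _.
  by apply: (aug_degS ep (n := n)); apply: phi_deg.
move=> a; apply: (submod_span (Y := [set a | p (phi a) = 0])).
  exact: (ker_submod (p \o phi)).
move=> _ [[|[j x] s] // s_gt0 ->] /=.
rewrite word_cons rmorphM (linear_projection_mul ep) //=; last exact: ephi.
by rewrite -word1 ephi.
Qed.

End Comparison.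

Section InducedHomotopy.
Variables (K : fieldType) (char0 : [pchar K] =i pred0) (O : comAlgType K).
Variables (I : {pred O}) (R : koszul_tate I).
Local Notation B := (kt_sym R).
Local Notation d := (kt_diff R).
Local Notation gen := (sym_gen B).
Local Notation P := (path_alg (parity B)).
Local Notation "p ^s" := (map_poly (parity B) p) (at level 2, format "p ^s").
Local Notation int := (@poly_int K O B).

(** The dt-part of a product has two terms, each with a factor of type [.1] and a factor of type
    [.2]. Their coefficients have zero augmentation, so [p] kills every coefficient of the product;
    integration only rescales and shifts coefficients. *)
Lemma horner1_int_ge2 i (e : {linear B -> O^o}) (p : {linear B -> kt_mod R i})
  (G : {lrmorphism B -> P}) : linear_projection e p ->
  (forall n a, sym_deg n a -> path_deg n (G a)) ->
  forall a, sym_ge2 a -> p (int (G a).2).[1] = 0.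
Proof.
move=> ep Gdeg a.
have int_lin : linear (fun a => (int (G a).2).[1]).
  move=> c x y; rewrite linearP path_addE path_scaleE /= int_linear.
  by rewrite hornerD hornerZ -scalerAl mul1r.
apply: (submod_span (Y := [set a | p (int (G a).2).[1] = 0])).
  exact: (ker_submod (p \o linmap int_lin)).
have coef_int_eq0 (q : {poly B}) : (forall k, p q`_k = 0) -> p (int q).[1] = 0.
  move=> q0; rewrite (horner1_wide (leqnn _)) raddf_sum big1 // => k _.
  by rewrite coef_int /= linearZ /= q0 scaler0.
have pos s : (0 < size s)%N -> forall k, e (G (word B s)).1`_k = 0.
  move=> /kt_word_deg_gt0[->|]; first by move=> k; rewrite raddf0 coef0 raddf0.
  have := sym_deg_word B s; case: (sumn _) => // n /Gdeg[wn _] _ k.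
  exact/(aug_degS ep)/wn.
have dt n b : sym_deg n b -> forall k, e (G b).2`_k = 0.
  by move=> /Gdeg[_ bn] k; apply/(aug_degS ep)/bn.
move=> _ [[|[j x] s] // s_gt0 ->] /=; rewrite word_cons rmorphM path_mulE /=.
apply: coef_int_eq0 => k; rewrite coefD raddfD /= !coefM !raddf_sum /=.
rewrite !big1 ?addr0 // => l _; apply: (linear_projection_mul ep).
- exact/dt/sym_deg_gen.
- rewrite coef_map_linear; set b := _`_(k - l).
  have [bn _] := Gdeg _ _ (sym_deg_word B s).
  have eb : e b = 0 by apply: pos.
  rewrite /= (parityE (bn (k - l)%N)) -signr_odd mulr_sign.
  by case: odd; rewrite ?raddfN /= -/b eb ?oppr0.
- by have := pos [:: existT _ j x] erefl l; rewrite word1.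
- exact/dt/sym_deg_word.
Qed.

Variable chi : {lrmorphism B -> B}.
Hypothesis chi_deg : forall n a, sym_deg n a -> sym_deg n (chi a).
Hypothesis chi_diff : forall a, d (chi a) = chi (d a).

(** The homotopy formula is the dt-part of the compatibility of [G] with differentials, integrated
    from 0 to 1: the derivative term integrates to the difference of the end points, under
    parity. *)
Lemma homotopy_exists : exists h : {linear B -> B},
  [/\ forall n a, sym_deg n a -> sym_deg n.+1 (h a),
      forall a, h (d a) = d (h a) + parity B (a - chi a), h 1 = 0
    & forall i (e : {linear B -> O^o}) (p : {linear B -> kt_mod R i}),
        linear_projection e p -> forall a, sym_ge2 a -> p (h a) = 0].
Proof.
have [G [Gdeg Gdiff G0 G1]] := path_lift_exists char0 chi_deg chi_diff.
have h_lin : linear (fun a => (int (G a).2).[1]).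
  move=> c x y; rewrite linearP path_addE path_scaleE /= int_linear.
  by rewrite hornerD hornerZ -scalerAl mul1r.
exists (linmap h_lin); split.
- by move=> n a /Gdeg[_ an]; apply/horner1_deg/int_deg.
- move=> a; rewrite /= -Gdiff /= /path_diff_fun /=.
  (* Factors 1 are inserted so that [int_linear] applies as additivity. *)
  rewrite -[map_poly d _]scale1r -[1 in LHS](scale1r (1 : B)) int_linear !scale1r.
  rewrite hornerD !int_map !horner1_map int_deriv //.
  by rewrite hornerD hornerN hornerC -horner_coef0 G0 G1.
- rewrite /= rmorph1 /=.
  have -> : int 0 = 0 by apply/polyP => k; rewrite coef_int !coef0 scaler0.
  by rewrite horner0.
- by move=> i e p ep a a2; apply: (horner1_int_ge2 ep Gdeg a2).
Qed.

End InducedHomotopy.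

Section ReducedComparison.
Variables (K : fieldType) (char0 : [pchar K] =i pred0) (O : comAlgType K).
Variables (I J : {pred O}) (idealJ : idealr_closed J) (subIJ : {subset I <= J}).

Lemma linear_partP (R : koszul_tate I) i (e : {linear kt_sym R -> O^o})
  (p : {linear kt_sym R -> kt_mod R i.+1}) : linear_projection e p ->
  forall a, sym_deg i.+1 a -> sym_ge2 (a - sym_gen (kt_sym R) i.+1 (p a)).
Proof.
move=> ep a /sym_deg_decomposition[y ay]; have [_ _ pgen _ _] := ep.
have /eqP := linear_projection_ge2 ep ay.
by rewrite raddfB /= pgen subr_eq0 => /eqP ->.
Qed.

Lemma linear_part_linear (R : koszul_tate I) i c (x x' : kt_mod R i.+1) y y' :
  linear_part x y -> linear_part x' y' ->
  linear_part (c *: x + x') (c *: y + y').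
Proof.
move=> xy xy'; rewrite /linear_part 2!linearP /= linearP /= opprD addrACA -scalerBr.
exact: (@sym_ge2_submod _ _ (kt_sym R)).2.
Qed.

Lemma linear_part0 (R : koszul_tate I) i : linear_part (0 : kt_mod R i.+1) 0.
Proof. by rewrite /linear_part !raddf0 addr0; apply: submod0; apply: sym_ge2_submod. Qed.

(** Makes one term of the homotopy formula vanish modulo [J]. In degree 1 the differential of [z] is
    a scalar, killed since [h 1 = 0]; above, it is a generator with coefficients in [J] up to
    [sym_ge2]. *)
Lemma reduced_cycle_image (R : koszul_tate I) i (h : {linear kt_sym R -> kt_sym R})
  (p : {linear kt_sym R -> kt_mod R i.+1}) :
  h 1 = 0 -> (forall a, sym_ge2 a -> p (h a) = 0) ->
  forall z, reduced_cycles R J i.+1 z ->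
  ideal_smul J (p (h (kt_diff R (sym_gen (kt_sym R) i.+1 z)))).
Proof.
move=> h1 ph2 z; have dz := kt_diff_degS (sym_deg_gen (kt_sym R) z).
case: i => [|i] in z p ph2 dz *.
  move=> _; have [c ->] := kt_deg0_scalar dz.
  rewrite linearZ /= h1 scaler0 raddf0.
  by apply: submod0; apply: ideal_smul_submod.
move=> [y /ph2/eqP + Jy]; rewrite raddfB /= raddfB /= subr_eq0 => /eqP ->.
exact: (ideal_smul_linear (p \o (h \o sym_gen (kt_sym R) i.+1))).
Qed.

Variables R R' : koszul_tate I.

Lemma reduced_comparison i : (0 < i)%N ->
  exists f : {linear kt_mod R i -> kt_mod R' i}, forall z,
    reduced_cycles R J i z -> ideal_smul J (f z) -> reduced_boundaries R J i z.
Proof.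
case: i => // i _.
have [phi [phi_deg phi_diff]] := kt_morphism_exists R R'.
have [psi [psi_deg psi_diff]] := kt_morphism_exists R' R.
have [e [p ep]] := linear_projection_exists (kt_sym R) i.+1.
have [e' [p' ep']] := linear_projection_exists (kt_sym R') i.+1.
have [h [h_deg h_diff h1 h_ge2]] := @homotopy_exists K char0 O I R (psi \o phi)
  (fun n a an => psi_deg _ _ (phi_deg _ _ an))
  (fun a => etrans (psi_diff _) (congr1 psi (phi_diff a))).
exists (p' \o (phi \o sym_gen (kt_sym R) i.+1)) => z cz /= fz.
set d := kt_diff R in psi_diff phi_diff h_diff *.
set g := sym_gen (kt_sym R) in fz *.
have sJ := @ideal_smul_submod O (kt_mod R i.+1) J.
have [_ _ pgen _ _] := ep.
(* [phi] of [z] differs from its linear part by [sym_ge2], which [psi] followed by [p] kills; the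
   linear part lies in [J] times the generators by [fz]. *)
have phz : ideal_smul J (p (psi (phi (g _ z)))).
  have := linear_partP ep' (phi_deg _ _ (sym_deg_gen _ z)).
  move=> /(linear_projection_morphism_ge2 ep psi_deg)/eqP.
  rewrite raddfB /= raddfB /= subr_eq0 => /eqP ->.
  exact: (ideal_smul_linear (p \o (psi \o sym_gen (kt_sym R') i.+1))).
have hdz : ideal_smul J (p (h (d (g _ z)))).
  by apply: reduced_cycle_image => // a; apply: h_ge2 ep _.
have hz := h_deg _ _ (sym_deg_gen _ z); have dhz := kt_diff_degS hz.
have [y hzy] := sym_deg_decomposition hz.
have dy := kt_diff_degS (sym_deg_gen (kt_sym R) y).
(* Modulo [J], the element [h z] may be replaced by its linear part [y]. *)
have dhzy : ideal_smul J (p (d (h (g _ z)) - d (g _ y))).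
  by rewrite -raddfB; apply: (linear_projection_diff_ge2 ep idealJ subIJ).
have := congr1 p (h_diff (g _ z)).
have -> : parity (kt_sym R) (g _ z - psi (phi (g _ z))) =
    (-1) ^+ i.+1 *: (g _ z - psi (phi (g _ z))).
  rewrite (parityE (n := i.+1)).
    by rewrite -signr_odd mulr_sign -[in RHS]signr_odd scaler_sign.
  apply: (submodB (sym_deg_submod _ _)); first exact: sym_deg_gen.
  exact/psi_deg/phi_deg/sym_deg_gen.
rewrite raddfD /= linearZ /= raddfB /= pgen => hE.
(* Solving the projected homotopy formula for [z] leaves, modulo [J], minus the parity sign times
   the linear part of the differential of [y]. *)
exists (- (-1) ^+ i.+1 *: y), (- (-1) ^+ i.+1 *: p (d (g _ y))); split.
  rewrite -[X in linear_part X]addr0 -[X in linear_part _ X]addr0.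
  apply: linear_part_linear; last exact: linear_part0.
  exact: (linear_partP ep dy).
have -> : z - - (-1) ^+ i.+1 *: p (d (g _ y)) = p (psi (phi (g _ z))) +
    (-1) ^+ i.+1 *: (p (h (d (g _ z))) - p (d (h (g _ z)) - d (g _ y))).
  have -> : p (d (h (g _ z)) - d (g _ y)) = p (d (h (g _ z))) - p (d (g _ y)).
    exact: raddfB.
  rewrite hE opprB [_ + (_ - _)]addrC addrA subrK scalerDr scalerA -expr2.
  by rewrite sqrr_sign scale1r scaleNr opprK [RHS]addrCA subrKC addrC.
apply: (submodD sJ) => //; apply: (submodZ sJ); exact: submodB.
Qed.

End ReducedComparison.

(** * Dimension count *)

Section Enumerations.
Variable V : choiceType.

Lemma card_enum (X : set V) n : (X #= `I_n)%card ->
  exists g : 'I_n -> V,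
    [/\ forall k, X (g k), injective g & forall x, X x -> exists k, x = g k].
Proof.
move=> /card_set_bijP[f [fun_f inj_f surj_f]].
have g0 (k : 'I_n) : {x | X x /\ f x = k}.
  by apply: cid; have [x Xx fx] := surj_f k (ltn_ord k); exists x.
exists (fun k => projT1 (g0 k)); split=> [k|k l kl|x Xx].
- exact: (projT2 (g0 k)).1.
- by apply: val_inj; rewrite /= -(projT2 (g0 k)).2 kl (projT2 (g0 l)).2.
- have fx : (f x < n)%N by apply: fun_f.
  exists (Ordinal fx); have [Xg fg] := projT2 (g0 (Ordinal fx)).
  by apply: inj_f; rewrite ?fg //; apply: mem_set.
Qed.

Lemma infinite_enum (X : set V) n : infinite_set X ->
  exists g : 'I_n -> V, (forall k, X (g k)) /\ injective g.
Proof.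
move=> /(@infinite_set_fset _ _ n)[B BX le_nB].
case: n => [|n] in le_nB *.
  have g0 : 'I_0 -> V by case.
  by exists g0; split=> [[]|[]].
have [x0 _] : exists x, x \in B by apply/fset0Pn; rewrite -cardfs_gt0 (leq_trans _ le_nB).
have lt_kB (k : 'I_n.+1) : (k < size (enum_fset B))%N by apply: leq_trans le_nB.
exists (fun k => nth x0 (enum_fset B) k); split=> [k|k l /eqP].
  by apply: BX => /=; apply: mem_nth.
rewrite nth_uniq // ?fset_uniq // => /eqP; exact: val_inj.
Qed.

Lemma card_range n (g : 'I_n -> V) : injective g -> (range g #= `I_n)%card.
Proof.
move=> inj_g; apply: card_eq_trans (inj_card_eq _) _.
  by move=> k l _ _; apply: inj_g.
by rewrite card_eq_sym card_II.
Qed.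

End Enumerations.

Section Generators.
Variables (O : comNzRingType) (V : lmodType O).

Lemma basis_generators (X : set V) n : is_basis X -> (X #= `I_n)%card ->
  exists g : 'I_n -> V, forall v, exists a : 'I_n -> O, v = \sum_j a j *: g j.
Proof.
move=> [_ Xspan] /card_enum[g [_ _ gX]]; exists g => v.
pose Y := [set v | exists a : 'I_n -> O, v = \sum_j a j *: g j].
have spanv : span X v by rewrite Xspan.
apply: (submod_span (Y := Y) _ _ spanv) => [|_ /gX[k ->]].
  split=> [|c _ _ [a ->] [b ->]].
    by exists (fun=> 0); rewrite big1 // => j _; rewrite scale0r.
  exists (fun j => c * a j + b j); rewrite scaler_sumr -big_split.
  by apply: eq_bigr => j _; rewrite scalerDl scalerA.
exists (fun j => (j == k)%:R); rewrite (bigD1 k) //= eqxx scale1r.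
by rewrite big1 ?addr0 // => j /negPf ->; rewrite scale0r.
Qed.

End Generators.

Section LinearDependence.
Variables (K : fieldType) (O : comAlgType K) (J : {pred O}).
Hypothesis residueJ : residue_field_is_base J.

(** Reduce the coefficients of the [y j] on the generators to [K]. A matrix with more rows than
    columns has a nonzero left kernel vector; with these weights every coefficient evaluates to 0,
    hence lies in [J]. *)
Lemma dependent_mod_ideal (V : lmodType O) n (g : 'I_n -> V) m (y : 'I_m -> V) :
  (forall v, exists a : 'I_n -> O, v = \sum_j a j *: g j) -> (n < m)%N ->
  exists c : 'I_m -> K, (exists j, c j != 0) /\
    ideal_smul J (\sum_j (c j)%:A *: y j).
Proof.
have [ev evJ] := residueJ; move=> gen_g lt_nm.
have {gen_g}/choice[a ya] : forall j, exists a, y j = \sum_k a k *: g k.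
  by move=> j; apply: gen_g.
pose M : 'M[K]_(m, n) := \matrix_(j, k) ev (a j k).
have : kermx M != 0.
  rewrite kermx_eq0 /row_free; apply/eqP => rM.
  by have := rank_leq_col M; rewrite rM leqNgt lt_nm.
case/rowV0Pn => c /sub_kermxP cM c0.
have [j cj] : exists j, c 0 j != 0.
  apply: contra_notP (negP c0) => /forallNP c00; apply/eqP/rowP => j.
  by rewrite mxE; apply/eqP/negPn/negP; apply: c00.
exists (c 0); split; first by exists j.
have -> : \sum_j (c 0 j)%:A *: y j =
    \sum_k (\sum_j (c 0 j)%:A * a j k) *: g k.
  under eq_bigr do rewrite ya scaler_sumr.
  rewrite exchange_big; apply: eq_bigr => k _ /=.
  by rewrite scaler_suml; apply: eq_bigr => l _; rewrite scalerA.
apply: submod_sum => [|k _]; first exact: ideal_smul_submod.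
apply: ideal_smulZ; rewrite evJ raddf_sum.
have /rowP/(_ k) := cM; rewrite !mxE => cMk; rewrite -[X in _ == X]cMk.
apply/eqP/eq_bigr => l _.
by rewrite mxE /= rmorphM /= linearZ /= rmorph1 [_ *: _]mulr1.
Qed.

End LinearDependence.

(** * Independent cycles and the bound on Betti numbers *)

Section BettiBound.
Variables (K : fieldType) (char0 : [pchar K] =i pred0) (O : comAlgType K).
Variables (I J : {pred O}) (idealJ : idealr_closed J) (subIJ : {subset I <= J}).
Hypothesis residueJ : residue_field_is_base J.
Variable i : nat.
Hypothesis i_gt0 : (0 < i)%N.

Lemma reduced_boundaries_submod (R : koszul_tate I) :
  submod (reduced_boundaries R J i).
Proof.
have sJ := @ideal_smul_submod O (kt_mod R i) J.
split; first by exists 0, 0; split; [exact: linear_part0|rewrite subr0; exact: submod0].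
move=> c x x' [z [y [zy xy]]] [z' [y' [zy' xy']]].
exists (c *: z + z'), (c *: y + y'); split; first exact: linear_part_linear.
by rewrite opprD addrACA -scalerBr; apply: sJ.2.
Qed.

Lemma reduced_cycles_submod (R : koszul_tate I) :
  submod (reduced_cycles R J i).
Proof.
case: i => [|[|k]] //=.
have sJ := @ideal_smul_submod O (kt_mod R k.+1) J.
split=> [|c x x' [y xy Jy] [y' xy' Jy']].
  by exists 0; [exact: linear_part0|exact: submod0].
by exists (c *: y + y'); [exact: linear_part_linear|exact: sJ.2].
Qed.

Definition independent_cycles (R : koszul_tate I) m (x : 'I_m -> kt_mod R i) :=
  (forall j, reduced_cycles R J i (x j)) /\
  forall c : 'I_m -> K, reduced_boundaries R J i (\sum_j (c j)%:A *: x j) ->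
    forall j, c j = 0.

(** Two resolutions appear because [betti] may use one unrelated to the generators [g]. The case
    [R = R'] also serves, to bound the families from which a basis is extracted. *)
Lemma independent_cycles_bound (R R' : koszul_tate I) n (g : 'I_n -> kt_mod R' i) :
  (forall v, exists a : 'I_n -> O, v = \sum_j a j *: g j) ->
  forall m (x : 'I_m -> kt_mod R i), independent_cycles x -> (m <= n)%N.
Proof.
move=> gen_g m x [x_cycle x_indep]; rewrite leqNgt; apply/negP => lt_nm.
have [f fP] := reduced_comparison char0 idealJ subIJ R R' i_gt0.
have [c [[j cj]]] := dependent_mod_ideal residueJ (f \o x) gen_g lt_nm.
rewrite (_ : \sum_j _ = f (\sum_j (c j)%:A *: x j)); last first.
  by rewrite linear_sum; apply: eq_bigr => k _; rewrite linearZ.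
move=> /fP cz; move: cj; rewrite (x_indep c) ?eqxx //; apply: cz.
apply: (submod_sum (reduced_cycles_submod R)) => k _.
exact: (submodZ (reduced_cycles_submod R)).
Qed.

Lemma basis_mod_independent (R : koszul_tate I) (X : set (kt_mod R i)) m
  (x : 'I_m -> kt_mod R i) :
  is_basis_mod (reduced_cycles R J i) (reduced_boundaries R J i) X ->
  (forall j, X (x j)) -> injective x -> independent_cycles x.
Proof.
move=> [XZ Xindep _] Xx inj_x; split=> [j|c]; first exact: XZ.
exact: Xindep.
Qed.

Lemma independent_cycles_injective (R : koszul_tate I) m
  (x : 'I_m -> kt_mod R i) : independent_cycles x -> injective x.
Proof.
move=> [_ x_indep] k l xkl; apply/eqP/negPn/negP => ne_kl.
pose c j : K := (j == k)%:R - (j == l)%:R.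
have /eqP : c k = 0.
  apply: x_indep; rewrite (_ : \sum_j _ = 0).
    by apply: submod0; apply: reduced_boundaries_submod.
  rewrite (bigD1 k) // (bigD1 l) /=; last by rewrite eq_sym.
  rewrite big1 ?addr0 => [|j /andP[/negPf jk /negPf jl]]; last first.
    by rewrite /c jk jl subrr !scale0r.
  rewrite /c !eqxx (negPf ne_kl) eq_sym (negPf ne_kl) subr0 sub0r xkl.
  by rewrite scaleNr !scale1r scaleN1r addrN.
by rewrite /c eqxx (negPf ne_kl) subr0 oner_eq0.
Qed.

Lemma maximal_independent_basis (R : koszul_tate I) m (x : 'I_m -> kt_mod R i) :
  independent_cycles x ->
  (forall x' : 'I_m.+1 -> kt_mod R i, ~ independent_cycles x') ->
  is_basis_mod (reduced_cycles R J i) (reduced_boundaries R J i) (range x).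
Proof.
move=> x_ind x_max; have inj_x := independent_cycles_injective x_ind.
have [x_cycle x_indep] := x_ind; have sB := reduced_boundaries_submod R.
split=> [_ [j _ <-]//|n y c inj_y y_x By j|z Zz].
  have /choice[k yk] : forall j, exists k, x k = y j.
    by move=> l; have [k _ <-] := y_x l; exists k.
  have inj_k : injective k by move=> a b kab; apply: inj_y; rewrite -!yk kab.
  (* The vectors [y] are a reindexing of part of [x]; [c'] carries their coefficients over to
     [x]. *)
  pose c' l := \sum_(j | k j == l) c j.
  have <- : c' (k j) = c j.
    by rewrite /c' (big_pred1 j) // => l; rewrite (inj_eq inj_k).
  apply: x_indep; rewrite (_ : \sum_l _ = \sum_j (c j)%:A *: y j) //.
  rewrite (partition_big k xpredT) //=; apply: eq_bigr => l _.
  rewrite /c' !scaler_suml; apply: eq_bigr => q /eqP kq.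
  by rewrite -yk kq.
pose x' (j : 'I_m.+1) := if unlift ord_max j is Some k then x k else z.
have x'_cycle j : reduced_cycles R J i (x' j) by rewrite /x'; case: unlift.
have [c [Bc [j cj]]] : exists c : 'I_m.+1 -> K,
    reduced_boundaries R J i (\sum_j (c j)%:A *: x' j) /\ exists j, c j != 0.
  apply: contra_notP (x_max x') => no_c; split=> // c Bc j.
  by apply/eqP/negPn/negP => cj; apply: no_c; exists c; split=> //; exists j.
have sumE : \sum_j (c j)%:A *: x' j =
    (c ord_max)%:A *: z + \sum_j (c (lift ord_max j))%:A *: x j.
  rewrite (bigD1_ord ord_max) //= /x' unlift_none; congr (_ + _).
  by apply: eq_bigr => k _; rewrite liftK.
(* Otherwise the relation would involve [x] alone and be trivial; so it can be solved for [z]. *)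
have cmax : c ord_max != 0.
  apply: contraNneq cj => c0; case: (unliftP ord_max j) => [k ->|-> //].
    apply/eqP; apply: (x_indep (fun k => c (lift ord_max k))).
    by move: Bc; rewrite sumE c0 !scale0r add0r.
  by rewrite c0.
exists m, x, (fun k => - (c ord_max)^-1 * c (lift ord_max k)); split.
  by move=> k; exists k.
have -> : z - \sum_k (- (c ord_max)^-1 * c (lift ord_max k))%:A *: x k =
    ((c ord_max)^-1)%:A *: \sum_j (c j)%:A *: x' j.
  rewrite sumE scalerDr scalerA -scalerAl mul1r scalerA mulVf // !scale1r.
  congr (_ + _); rewrite -sumrN scaler_sumr; apply: eq_bigr => k _.
  by rewrite mulNr scaleNr scaleNr opprK scalerA -scalerAl mul1r scalerA.
exact: (submodZ sB).
Qed.

(** As [betti] is an [xget] with default [None], bounding every admissible value is not enough: one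
    must exist. It is the size of a largest independent family of cycles of [R], which exists
    because these sizes are at most [n]. *)
Lemma betti_le_generators (R : koszul_tate I) n (g : 'I_n -> kt_mod R i) :
  (forall v, exists a : 'I_n -> O, v = \sum_j a j *: g j) ->
  le_enat (betti I J i) (Some n).
Proof.
move=> gen_g; rewrite /betti.
set bs := (X in xget _ X).
have bs_le b : bs b -> le_enat b (Some n).
  move=> [R' [X [X_basis]]]; case: b => [m|] /=.
    move=> /card_enum[x [Xx inj_x _]].
    exact/(independent_cycles_bound gen_g)/(basis_mod_independent X_basis).
  (* An infinite basis would contain [n.+1] independent cycles, one too many. *)
  move=> /(@infinite_enum _ _ n.+1)[x [Xx inj_x]].
  suff : (n.+1 <= n)%N by rewrite ltnn.
  exact/(independent_cycles_bound gen_g)/(basis_mod_independent X_basis).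
apply: bs_le; apply: xgetPex.
pose has_family m := `[< exists x : 'I_m -> kt_mod R i, independent_cycles x >].
have fam0 : exists m, has_family m.
  exists 0%N; apply/asboolP; exists (fun=> 0); by split=> [[]|c _ []].
have fam_le m : has_family m -> (m <= n)%N.
  by move=> /asboolP[x]; apply: independent_cycles_bound gen_g _ _.
have [m [/asboolP[x x_ind] m_max]] : exists m, has_family m /\
    forall m', has_family m' -> (m' <= m)%N.
  by case: (ex_maxnP fam0 fam_le) => m; exists m.
exists (Some m), R, (range x); split; last first.
  exact/card_range/independent_cycles_injective.
apply: maximal_independent_basis => // x' x'_ind.
by have := m_max m.+1 (asboolT (ex_intro _ x' x'_ind)); rewrite ltnn.
Qed.

End BettiBound.

Theorem theoremC10 (K : fieldType) (char0 : [pchar K] =i pred0)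
    (O : comAlgType K) (I : {pred O}) (idealI : idealr_closed I)
    (R : koszul_tate I)
    (freeR : forall j : nat, (1 <= j)%N -> is_free (kt_mod R j))
    (J : {pred O}) (maxJ : maximal_ideal J)
    (residueJ : residue_field_is_base J) (subIJ : {subset I <= J})
    (i : nat) (i_ge1 : (1 <= i)%N) :
  le_enat (betti I J i) (rank (kt_mod R i)).
Proof.
case: maxJ => idealJ _.
(* The value [None] dominates everything, so only a finite basis needs an argument. *)
rewrite /rank; case: xgetP => [[n|] _ [X X_basis X_card]|_]; last 2 first.
- by case: betti.
- by case: betti.
have [g gen_g] := basis_generators X_basis X_card.
exact: (betti_le_generators char0 idealJ subIJ residueJ i_ge1 gen_g).
Qed.
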